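(* For $1<p<\infty$ and $1/p+1/q=1$, we have $$\mathcal{M}(\mathcal{H}(ces_p))=\mathcal{A}^{1/q}$$ with equality of norms, that is, $\|f\|_{\mathcal{M}(\mathcal{H}(ces_p))}=\|f\|_{\mathcal{A}^{1/q}}$ for every $f$ in this space.
   Context: For $\theta\in\mathbb{R}$, $\mathbb{C}_\theta:=\{s\in\mathbb{C}:\Re(s)>\theta\}$. For $1<p<\infty$, the Ces\`aro sequence space $ces_p$ consists of all complex sequences $(a_n)_{n=1}^\infty$ with $$\|(a_n)_{n=1}^\infty\|_{ces_p}:=\Big(\sum_{n=1}^\infty\Big(\frac1n\sum_{k=1}^n|a_k|\Big)^p\Big)^{1/p}<\infty.$$ $\mathcal{H}(ces_p)$ is the Banach space of all Dirichlet series $f(s)=\sum_{n=1}^\infty a_nn^{-s}$ with $(a_n)_{n=1}^\infty\in ces_p$, with norm $\|f\|_{\mathcal{H}(ces_p)}:=\|(a_n)_{n=1}^\infty\|_{ces_p}$. Every such $f$ converges absolutely, hence is analytic, on $\mathbb{C}_{1/q}$. A multiplier on $\mathcal{H}(ces_p)$ is an analytic function $f$ on $\mathbb{C}_{1/q}$ such that $fg\in\mathcal{H}(ces_p)$ for every $g\in\mathcal{H}(ces_p)$ (pointwise product; in terms of coefficients it is the Dirichlet convolution $(a\cdot b)_n=\sum_{k|n}a_kb_{n/k}$). $\mathcal{M}(\mathcal{H}(ces_p))$ is the set of all multipliers on $\mathcal{H}(ces_p)$; it is contained in $\mathcal{H}(ces_p)$, each multiplier $f$ defines a bounded operator $M_f:g\mapsto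 fg$ on $\mathcal{H}(ces_p)$, and $\|f\|_{\mathcal{M}(\mathcal{H}(ces_p))}$ denotes the operator norm of $M_f$. For $r\in\mathbb{R}$, $\mathcal{A}^r$ is the space of all Dirichlet series $f(s)=\sum_{n=1}^\infty a_nn^{-s}$ with $\|f\|_{\mathcal{A}^r}:=\sum_{n=1}^\infty|a_n|n^{-r}<\infty$. *)

(* Defs.v *)
From HB Require Import structures.
From mathcomp Require Export all_boot all_order all_algebra.
From mathcomp Require Export all_classical all_reals all_analysis.
From mathcomp Require Export complex.
Export numFieldNormedType.Exports.

Set Implicit Arguments.
Unset Strict Implicit.
Unset Printing Implicit Defensive.

Import Order.TTheory GRing.Theory Num.Theory.
Local Open Scope classical_set_scope.
Local Open Scope ring_scope.
Local Open Scope complex_scope.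

Section DirichletSeries.
Context {R : realType}.

(* The alias [R[i]^o] carries the norm topology of the complex numbers. *)
Local Notation C := (R[i]^o).
Implicit Types (a : nat -> C) (f g : C -> C) (p q r theta : R).

(* The norm of the library on [R[i]] takes its values in [R[i]]. *)
Definition cabs (z : R[i]) : R := complex.Re `|z|.

Definition cexp (z : R[i]) : R[i] :=
  (expR (complex.Re z))%:C * (cos (complex.Im z) +i* sin (complex.Im z)).

(* [dpow n s] is n^{-s}, for a positive integer n. *)
Definition dpow (n : nat) (s : R[i]) : R[i] := cexp (- s * (ln n%:R)%:C).

Definition halfplane theta : set C := [set s | theta < complex.Re s].

(* Differentiability in the direction 1 over the field of complex numbers is
   complex differentiability, as the increment ranges over complex numbers. *)
Definition analytic_on (A : set C) f := forall s, A s -> derivable f s 1.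

(* Sequences (a_n)_{n >= 1} are indexed from 0: [a n] stands for a_{n+1}.
   Functions on a half-plane are represented by total functions, of which only
   the restriction to that half-plane is ever constrained. *)
Definition dirichlet_on theta a f := forall s, halfplane theta s ->
  series (fun n => a n * dpow n.+1 s : C) @ \oo --> f s.

(* The sequence of coefficients of a Dirichlet series; it is unique, since a
   Dirichlet series that vanishes on a half-plane has zero coefficients. *)
Definition dirichlet_coef theta f : nat -> C :=
  xget (fun=> 0) [set a | dirichlet_on theta a f].

Definition ces_norm p a : \bar R :=
  ((\sum_(n <oo) ((n.+1%:R^-1 * \sum_(k < n.+1) cabs (a k)) `^ p)%:E)
     `^ p^-1)%E.

Definition ces p : set (nat -> C) := [set a | (ces_norm p a < +oo)%E].

(* In the following q is the conjugate exponent of p. *)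
Definition Hces p q : set (C -> C) :=
  [set f | exists2 a, ces p a & dirichlet_on q^-1 a f].

Definition Hces_norm p q f : \bar R := ces_norm p (dirichlet_coef q^-1 f).

Definition Multipliers p q : set (C -> C) :=
  [set f | analytic_on (halfplane q^-1) f /\
           forall g, Hces p q g -> Hces p q (f \* g)].

(* The operator norm of g |-> f g. *)
Definition Multipliers_norm p q f : \bar R :=
  ereal_sup [set Hces_norm p q (f \* g) |
             g in [set g | Hces p q g /\ (Hces_norm p q g <= 1)%E]].

Definition weighted_l1_norm r a : \bar R :=
  (\sum_(n <oo) (cabs (a n) * n.+1%:R `^ (- r))%:E)%E.

Definition Aspace r : set (C -> C) :=
  [set f | exists2 a, (weighted_l1_norm r a < +oo)%E & dirichlet_on r a f].

Definition Aspace_norm r f : \bar R := weighted_l1_norm r (dirichlet_coef r f).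

End DirichletSeries.

(* Main.v *)
Require Import Defs.
From mathcomp Require Import ring lra zify.

(** Write r = 1/q and B_n for the partial sums of |b_k|.  Multiplication by
    m^{-s} replaces B_n by B_{n/m}, and summing over blocks of length m shows
    that it has norm at most m^{-r} on ces_p; Minkowski's inequality then gives
    ||f g|| <= ||f||_{A^r} ||g||.

    Conversely let g be supported on the integers N m + 1 with 1 <= m <= L.  If
    N > D L, then the coefficient of f g at k (N m + 1), k <= D, is exactly
    a_k g_{N m + 1}: a coincidence k (N m + 1) = k' (N m' + 1) forces m = m', as
    N m' + 1 would divide k (m - m').  So no cancellation occurs.  Choose the
    values of g such that their partial sums over m <= j are min(j, L)^r.  Up to
    the common factor N^{1-p}, the p-th power of the norm of g is then at most
    ln L + O(1), and that of f g is at least T^p (ln L - O(1)), where T is the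
    sum of |a_k| k^{-r} over k <= D.  Letting L tend to infinity, the norm of f
    as a multiplier is at least T.

    That a multiplier f belongs to A^r, that is, that multiplication by f is
    bounded, is shown by a gliding hump: otherwise sums of the test sequences
    above, with rapidly increasing N, produce g in ces_p with f g not in ces_p. *)

Set Implicit Arguments.
Unset Strict Implicit.
Unset Printing Implicit Defensive.

Import Order.TTheory GRing.Theory Num.Theory.
Local Open Scope classical_set_scope.
Local Open Scope ring_scope.
Local Open Scope complex_scope.

(** * Minkowski's inequality and sums over blocks *)

Section RealSums.
Context {R : realType}.
Implicit Types (p : R) (u v : nat -> R).

Lemma powR_le p (x y : R) : 0 <= p -> 0 <= x -> x <= y -> x `^ p <= y `^ p.
Proof.
by move=> p0 x0 xy; apply: ge0_ler_powR => //; rewrite nnegrE// (le_trans x0).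
Qed.

Lemma powR_le_inv p (x y : R) : 0 < p -> 0 <= x -> 0 <= y ->
  x `^ p <= y `^ p -> x <= y.
Proof.
move=> p0 x0 y0; apply: contraTT; rewrite -!ltNge => yx.
by apply: gt0_ltr_powR; rewrite ?nnegrE.
Qed.

Lemma powR_anti (x y s : R) : 0 <= s -> 0 < x -> x <= y -> y `^ (- s) <= x `^ (- s).
Proof.
move=> s0 x0 xy; rewrite !powRN lef_pV2 ?posrE ?powR_gt0//; last by lra.
by apply: powR_le => //; exact: ltW.
Qed.

Lemma powR_mulN p (x : R) : 0 <= x -> x `^ (- p) = x^-1 `^ p.
Proof. by move=> x0; rewrite -powR_inv1// -powRrM mulN1r. Qed.

Lemma ler_sum_widen (F : nat -> R) m n : (forall i, 0 <= F i) -> (m <= n)%N ->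
  \sum_(i < m) F i <= \sum_(i < n) F i.
Proof.
move=> F0 mn; rewrite -(subnKC mn) big_split_ord/= lerDl.
by apply: sumr_ge0.
Qed.

(* The sum over the indices below 2X + 1 is at most 1 + 2^{1-p} times the sum
   over those below X. *)
Lemma zeta_bounded p : 1 < p ->
  exists2 Z : R, 0 <= Z & forall X, \sum_(n < X) n.+1%:R `^ (- p) <= Z.
Proof.
move=> p1; set S := fun X => \sum_(n < X) (n.+1%:R : R) `^ (- p).
set c : R := 2 `^ (1 - p).
have c1 : c < 1.
  rewrite /c -opprB powRN invf_lt1 ?powR_gt0//.
  have := @gt0_ltr_powR R (p - 1) _ 1 2.
  by rewrite !nnegrE powR1; apply => //; lra.
have SS X : S (X + X).+1 <= 1 + c * S X.
  elim: X => [|X IH].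
    by rewrite /S addn0 big_ord0 big_ord_recr big_ord0/= powR1; lra.
  rewrite /S addnS addSn; do 2 rewrite big_ord_recr /=.
  rewrite -/(S (X + X).+1) [in leRHS]big_ord_recr/= -/(S X).
  have cE : c * X.+1%:R `^ (- p) = 2 * (X + X).+2%:R `^ (- p).
    have -> : ((X + X).+2%:R : R) = 2 * X.+1%:R by rewrite -natrM; congr (_%:R); lia.
    rewrite powRM// mulrA /c powRD ?powRr1//.
    by rewrite pnatr_eq0 implybT.
  have : ((X + X).+3%:R : R) `^ (- p) <= (X + X).+2%:R `^ (- p).
    by apply: powR_anti => //; [lra|rewrite ler_nat].
  by rewrite mulrDr cE; lra.
(* [S X <= S (X + X).+1 <= 1 + c * S X] gives [(1 - c) * S X <= 1]. *)
exists (1 - c)^-1; first by rewrite invr_ge0; lra.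
move=> X; have le1 : S X <= S (X + X).+1.
  by apply: (@ler_sum_widen (fun n => n.+1%:R `^ (- p))); [move=> i; exact: powR_ge0 | lia].
rewrite -/(S X) -[leRHS]mul1r ler_pdivlMr; last by lra.
by have := SS X; nra.
Qed.

Lemma powR_convex p (t x y : R) : 1 <= p -> 0 <= t -> t <= 1 -> 0 <= x -> 0 <= y ->
  (t * x + (1 - t) * y) `^ p <= t * x `^ p + (1 - t) * y `^ p.
Proof.
move=> p1 t0 t1 x0 y0.
have := @convex_powR R p p1 (Itv01 t0 t1) x y.
rewrite !convRE/= /unstable.onem; apply; rewrite inE/= in_itv/= ?x0 ?y0//.
Qed.

(** Convexity of x^p, applied to (u + v) / (al + be) as the mean of u / al and v / be with weights
    al / (al + be) and be / (al + be). Stating it for upper bounds [al] and [be] avoids p-th roots;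
    the cases [al = 0] and [be = 0] are treated apart, because of the divisions. *)
Lemma minkowski_sum p X u v (al be : R) : 1 < p -> 0 <= al -> 0 <= be ->
  (forall n, 0 <= u n) -> (forall n, 0 <= v n) ->
  \sum_(n < X) u n `^ p <= al `^ p -> \sum_(n < X) v n `^ p <= be `^ p ->
  \sum_(n < X) (u n + v n) `^ p <= (al + be) `^ p.
Proof.
move=> p1 al0 be0 u0 v0.
have zero w : (forall n, 0 <= w n) -> \sum_(n < X) w n `^ p <= 0 `^ p ->
    forall n : 'I_X, w n = 0.
  move=> w0; rewrite powR0; last by lra.
  move=> s0 n; apply: (@powR_eq0_eq0 _ _ p); apply/eqP; rewrite eq_le powR_ge0 andbT.
  apply: le_trans s0; rewrite (bigD1 n)//= lerDl.
  by apply: sumr_ge0 => i _; exact: powR_ge0.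
have [->|alN0] := eqVneq al 0.
  move=> /zero uz; rewrite add0r; apply: le_trans; rewrite le_eqVlt; apply/orP; left.
  by apply/eqP/eq_bigr => i _; rewrite uz// add0r.
have [->|beN0] := eqVneq be 0.
  move=> su /zero vz; rewrite addr0; apply: le_trans su.
  rewrite le_eqVlt; apply/orP; left.
  by apply/eqP/eq_bigr => i _; rewrite vz// addr0.
have {alN0}al1 : 0 < al by rewrite lt0r alN0.
have {beN0}be1 : 0 < be by rewrite lt0r beN0.
move=> su sv; set t := al / (al + be).
have s0 : 0 < al + be by lra.
have t0 : 0 <= t by rewrite /t divr_ge0; lra.
have t1 : t <= 1 by rewrite /t ler_pdivrMr; lra.
have tE : 1 - t = be / (al + be) by rewrite /t; field; lra.
have key n : (u n + v n) `^ p <=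
    (al + be) `^ p * (t * (u n `^ p / al `^ p) + (1 - t) * (v n `^ p / be `^ p)).
  have -> : u n + v n = (al + be) * (t * (u n / al) + (1 - t) * (v n / be)).
    by rewrite tE /t; field; rewrite !gt_eqF.
  rewrite powRM; [|lra|]; last first.
    by rewrite addr_ge0// mulr_ge0// ?divr_ge0//; lra.
  rewrite ler_pM2l ?powR_gt0//.
  have -> : u n `^ p / al `^ p = (u n / al) `^ p.
    by rewrite powRM ?invr_ge0// -powR_mulN// powRN.
  have -> : v n `^ p / be `^ p = (v n / be) `^ p.
    by rewrite powRM ?invr_ge0// -powR_mulN// powRN.
  by apply: powR_convex; rewrite ?divr_ge0// ltW.
apply: le_trans; first by apply: ler_sum => i _; exact: key.
rewrite -mulr_sumr -[leRHS]mulr1 ler_pM2l ?powR_gt0// big_split/=.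
rewrite -!mulr_sumr -!mulr_suml.
have a1 : (\sum_(i < X) u i `^ p) / al `^ p <= 1.
  by rewrite ler_pdivrMr ?powR_gt0// mul1r.
have b1 : (\sum_(i < X) v i `^ p) / be `^ p <= 1.
  by rewrite ler_pdivrMr ?powR_gt0// mul1r.
nra.
Qed.

Lemma minkowski_big p X (I : nat) (c be : nat -> R) (w : nat -> nat -> R) :
  1 < p -> (forall k, 0 <= c k) -> (forall k, 0 <= be k) ->
  (forall k n, 0 <= w k n) ->
  (forall k, \sum_(n < X) w k n `^ p <= be k `^ p) ->
  \sum_(n < X) (\sum_(k < I) c k * w k n) `^ p <= (\sum_(k < I) c k * be k) `^ p.
Proof.
move=> p1 c0 be0 w0 wbe; elim: I => [|I IH].
  rewrite big_ord0 big1// => i _; rewrite big_ord0//.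
  by rewrite powR0//; lra.
rewrite big_ord_recr/= (eq_bigr (fun n : 'I_X =>
  (\sum_(k < I) c k * w k n + c I * w I n) `^ p)); last first.
  by move=> i _; rewrite big_ord_recr.
apply: (@minkowski_sum p X (fun n => \sum_(k < I) c k * w k n)
  (fun n => c I * w I n)) => //.
- by apply: sumr_ge0 => k _; rewrite mulr_ge0.
- by rewrite mulr_ge0.
- by move=> n; apply: sumr_ge0 => k _; rewrite mulr_ge0.
- by move=> n; rewrite mulr_ge0.
rewrite powRM//; under eq_bigr do rewrite powRM//.
by rewrite -mulr_sumr ler_wpM2l ?powR_ge0.
Qed.

(* Splits the summation range into blocks of length [k], on which [n %/ k] is
   constant. *)
Lemma block_sum p X k (B : nat -> R) : 1 < p -> (0 < k)%N -> B 0%N = 0 ->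
  (forall j, 0 <= B j) ->
  \sum_(n < X) (B (n.+1 %/ k)%N / n.+1%:R) `^ p <=
  k%:R `^ (1 - p) * \sum_(j < X) (B j.+1 / j.+1%:R) `^ p.
Proof.
move=> p1 k0 B00 B0.
have pn0 : p != 0 by rewrite gt_eqF//; lra.
pose F n := (B (n %/ k)%N / n%:R) `^ p.
have F0 n : 0 <= F n by exact: powR_ge0.
apply: (@le_trans _ _ (\sum_(n < X.+1 * k) F n)).
  apply: (@le_trans _ _ (\sum_(n < X.+1) F n)).
    by rewrite big_ord_recl /= lerDr.
  by apply: ler_sum_widen => //; rewrite leq_pmulr.
(* The block of the indices below [k] vanishes because [B 0 = 0]. *)
rewrite -(big_mkord predT) big_nat_mul big_mkord big_ord_recl /= big_nat big1 ?add0r; last first.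
  move=> i /andP[_]; rewrite mul1n => ik.
  by rewrite /F divn_small// B00 mul0r powR0.
rewrite mulr_sumr; apply: ler_sum => j _; rewrite /bump /= add1n.
have := B0 j.+1; set b := B j.+1 => b0.
(* On this block the numerator is constantly [b], and each denominator is at least the left end of
   the block. *)
apply: (@le_trans _ _ (\sum_(j.+1 * k <= i < j.+2 * k) (b / (j.+1 * k)%:R) `^ p)).
  rewrite big_nat [leRHS]big_nat; apply: ler_sum => i /andP[h1 h2].
  have -> : F i = (b / i%:R) `^ p.
    rewrite /F /b; suff -> : (i %/ k = j.+1)%N by []; apply/eqP.
    by rewrite eqn_leq leq_divRL// h1 andbT -ltnS ltn_divLR.
  apply: powR_le; [lra| |]; first by rewrite divr_ge0 ?B0.
  rewrite ler_wpM2l// lef_pV2 ?posrE ?ltr0n ?ler_nat//; first by nia.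
  by rewrite muln_gt0.
rewrite sumr_const_nat (_ : (_ - _)%N = k); last by nia.
rewrite natrM invfM mulrA powRM ?divr_ge0// -mulr_natr.
rewrite powRB; last by apply/implyP => _; rewrite pnatr_eq0 -lt0n.
rewrite powRr1// -powR_mulN// powRN mul1r le_eqVlt; apply/orP; left; apply/eqP.
ring.
Qed.

End RealSums.

(** * Dirichlet convolution and Cesaro norms *)

Section Hyperbola.
Variable V : nmodType.
Implicit Types F : nat -> nat -> V.

(** Both factors of [n.+1] are at most [n.+1], so the larger ranges add no pair. They no longer
    depend on [n], which permits exchanging sums. *)
Lemma divisor_sum_widen F n X : (n < X)%N ->
  \sum_(k < n.+1) \sum_(j < n.+1 | (k.+1 * j.+1 == n.+1)%N) F k j =
  \sum_(k < X) \sum_(j < X | (k.+1 * j.+1 == n.+1)%N) F k j.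
Proof.
move=> nX.
transitivity (\sum_(k < n.+1) \sum_(j < X | (k.+1 * j.+1 == n.+1)%N) F k j).
  apply: eq_bigr => k _.
  rewrite (big_ord_widen_cond X (fun j => k.+1 * j.+1 == n.+1)%N (F k))//.
  by apply: eq_bigl => j; apply/andP/idP => [[]//|/eqP E]; split; [exact/eqP|nia].
rewrite (big_ord_widen X (fun k => \sum_(j < X | (k.+1 * j.+1 == n.+1)%N) F k j))//.
rewrite big_mkcond; apply: eq_bigr => k _; case: ifPn => // nk.
by rewrite big1// => j /eqP; nia.
Qed.

(** Both sides run over the pairs with [k.+1 * j.+1 <= X], on the left grouped by their product and
    on the right by their first factor. *)
Lemma hyperbola F X :
  \sum_(n < X) \sum_(k < n.+1) \sum_(j < n.+1 | (k.+1 * j.+1 == n.+1)%N) F k j =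
  \sum_(k < X) \sum_(j < X %/ k.+1) F k j.
Proof.
under eq_bigr => n _ do rewrite (@divisor_sum_widen F n X (ltn_ord n)).
rewrite exchange_big/=; apply: eq_bigr => k _.
under eq_bigr => n _ do rewrite big_mkcond.
rewrite exchange_big/= (big_ord_widen X (F k)) ?leq_div//.
rewrite [RHS]big_mkcond; apply: eq_bigr => j _.
rewrite -big_mkcond/= leq_divRL// mulnC; case: ifPn => jk.
  have m : ((k.+1 * j.+1).-1 < X)%N by nia.
  rewrite (big_pred1 (Ordinal m))// => n /=.
  by apply/eqP/eqP => [E|->]; [apply: val_inj; rewrite /=; nia | rewrite /=; nia].
by rewrite big1// => n /eqP; have := ltn_ord n; nia.
Qed.

End Hyperbola.

(* [N * m' + 1] divides [k * (m - m')], whose absolute value is less than [N]. *)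
Lemma test_factor_unique (D L N k m k' m' : nat) :
  (0 < k <= D)%N -> (0 < m <= L)%N -> (0 < m' <= L)%N -> (D * L < N)%N ->
  (k' * (N * m' + 1) = k * (N * m + 1))%N -> k' = k /\ m' = m.
Proof.
move=> kD mL m'L NDL E.
have mm : m = m'.
  have small x y z : (0 < y <= D * L)%N -> (0 < z)%N -> (y = x * (N * z + 1))%N -> False.
    by move=> yDL z0; case: x => [|x]; nia.
  have E' : (m' * k' * (N * m' + 1) = m' * k * (N * m + 1))%N by nia.
  case: (ltngtP m m') => // lt; exfalso.
    apply: (small (m' * k' - m * k)%N (k * (m' - m))%N m'); first by nia.
      by lia.
    by rewrite mulnBl E' mulnBr; nia.
  apply: (small (m * k - m' * k')%N (k * (m - m'))%N m'); first by nia.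
    by lia.
  by rewrite mulnBl E' mulnBr; nia.
split=> //; rewrite -{}mm in E.
by apply/eqP; rewrite -(eqn_pmul2r (m := (N * m + 1)%N)) ?addn1//; move: E; rewrite addn1 => ->.
Qed.

Section Cesaro.
Context {R : realType}.
Implicit Types (p : R) (A B C : nat -> R).

Definition ces_sum p X A : R :=
  \sum_(n < X) ((\sum_(k < n.+1) A k) / n.+1%:R) `^ p.

(* The norm of [A] in ces_p is at most [M]. *)
Definition ces_le p A (M : R) : Prop := forall X, ces_sum p X A <= M `^ p.

Lemma ler_ces_sum p X A B : 0 <= p -> (forall n, 0 <= A n) ->
  (forall n, (n <= X)%N -> \sum_(k < n) A k <= \sum_(k < n) B k) ->
  ces_sum p X A <= ces_sum p X B.
Proof.
move=> p0 A0 AB; apply: ler_sum => n _; apply: powR_le => //.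
  by rewrite divr_ge0//; apply: sumr_ge0.
by rewrite ler_wpM2r// AB.
Qed.

Lemma ces_sum_widen p X Y A : (X <= Y)%N -> ces_sum p X A <= ces_sum p Y A.
Proof.
move=> XY; apply: (@ler_sum_widen _
  (fun n => ((\sum_(k < n.+1) A k) / n.+1%:R) `^ p)) => // n; exact: powR_ge0.
Qed.

Lemma ces_leD p A B C (M M' : R) : 1 < p -> 0 <= M -> 0 <= M' ->
  (forall n, 0 <= A n) -> (forall n, 0 <= B n) -> (forall n, 0 <= C n) ->
  (forall n, C n <= A n + B n) ->
  ces_le p A M -> ces_le p B M' -> ces_le p C (M + M').
Proof.
move=> p1 M0 M'0 A0 B0 C0 CAB lA lB X; have p0 : 0 <= p by lra.
apply: le_trans (ler_ces_sum (B := fun n => A n + B n) p0 C0 _) _.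
  by move=> n _; apply: ler_sum.
rewrite /ces_sum.
under eq_bigr => n _ do rewrite big_split/= mulrDl.
apply: (@minkowski_sum _ p X (fun n => (\sum_(k < n.+1) A k) / n.+1%:R)
  (fun n => (\sum_(k < n.+1) B k) / n.+1%:R)) => //.
- by move=> n; rewrite divr_ge0//; apply: sumr_ge0.
- by move=> n; rewrite divr_ge0//; apply: sumr_ge0.
- exact: lA.
- exact: lB.
Qed.

Lemma ces_leZ p A (t M : R) : 0 <= t -> 0 <= M -> (forall n, 0 <= A n) ->
  ces_le p A M -> ces_le p (fun n => t * A n) (t * M).
Proof.
move=> t0 M0 A0 lA X; rewrite /ces_sum powRM//.
under eq_bigr => n _ do rewrite -mulr_sumr -mulrA powRM ?divr_ge0 ?sumr_ge0//.
by rewrite -mulr_sumr ler_wpM2l ?powR_ge0//; exact: lA.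
Qed.

(* The partial sums of [C] are dominated by those of the Dirichlet convolution of
   [A] and [B], written as in [hyperbola]; [p^-1 - 1] is -1/q. *)
Lemma ces_le_conv p A B C (T M : R) : 1 < p -> 0 <= M ->
  (forall n, 0 <= A n) -> (forall n, 0 <= B n) -> (forall n, 0 <= C n) ->
  (forall X, \sum_(n < X) C n <=
             \sum_(k < X) A k * \sum_(j < X %/ k.+1) B j) ->
  (forall X, \sum_(k < X) A k * k.+1%:R `^ (p^-1 - 1) <= T) ->
  ces_le p B M -> ces_le p C (T * M).
Proof.
move=> p1 M0 A0 B0 C0 CAB AT lB X; have p0 : 0 <= p by lra.
have sB0 m : 0 <= \sum_(j < m) B j by apply: sumr_ge0.
have T0 : 0 <= T by apply: le_trans (AT 0%N); rewrite big_ord0.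
apply: (@le_trans _ _ (\sum_(n < X) (\sum_(k < X) A k *
    ((\sum_(j < n.+1 %/ k.+1) B j) / n.+1%:R)) `^ p)).
  apply: ler_sum => n _; apply: powR_le => //.
    by rewrite divr_ge0//; apply: sumr_ge0.
  under [leRHS]eq_bigr => k _ do rewrite mulrA.
  rewrite -mulr_suml ler_wpM2r//; apply: le_trans (CAB n.+1) _.
  apply: (@ler_sum_widen _ (fun k => A k * \sum_(j < n.+1 %/ k.+1) B j)) => //.
  by move=> k; rewrite mulr_ge0.
(* Minkowski's inequality for the dilates of [B]: by [block_sum], the p-th power of the norm of the
   k-th one is at most (k + 1)^{1-p} M^p, and (1/p - 1) p = 1 - p. *)
apply: (@le_trans _ _ ((\sum_(k < X) A k * (k.+1%:R `^ (p^-1 - 1) * M)) `^ p)).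
  apply: (@minkowski_big _ p X X A (fun k => k.+1%:R `^ (p^-1 - 1) * M)
    (fun k n => (\sum_(j < n.+1 %/ k.+1) B j) / n.+1%:R)) => //.
  - by move=> k; rewrite mulr_ge0 ?powR_ge0.
  - by move=> k n; rewrite divr_ge0.
  move=> k.
  apply: le_trans (@block_sum _ p X k.+1 (fun m => \sum_(j < m) B j) _ _ _ _) _ => //.
    by rewrite big_ord0.
  rewrite powRM ?powR_ge0// -powRrM mulrBl mulVf ?mul1r; last by lra.
  by rewrite ler_wpM2l ?powR_ge0//; exact: lB.
apply: powR_le => //.
  by apply: sumr_ge0 => k _; rewrite !mulr_ge0 ?powR_ge0.
by under eq_bigr => k _ do rewrite mulrA; rewrite -mulr_suml ler_wpM2r.
Qed.

(** In each of the last N terms of [ces_sum] of length 2N the partial sum is at least the sum over k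
    < N and the denominator is at most 2N; so these N terms alone bound the sum. *)
Lemma ces_le_sum p A M : 1 < p -> 0 <= M -> (forall n, 0 <= A n) ->
  ces_le p A M -> forall N, \sum_(k < N) A k <= 2 * M * N%:R `^ (1 - p^-1).
Proof.
move=> p1 M0 A0 lA [|N]; first by rewrite big_ord0 !mulr_ge0// powR_ge0.
set s := \sum_(k < N.+1) A k.
have p0 : 0 < p by lra.
have s0 : 0 <= s by apply: sumr_ge0.
apply: (powR_le_inv p0) => //; first by rewrite !mulr_ge0 ?powR_ge0.
have h : N.+1%:R * (s / (2 * N.+1%:R)) `^ p <= M `^ p.
  apply: le_trans (lA (N.+1 + N.+1)%N).
  rewrite /ces_sum big_split_ord/=.
  apply: (@le_trans _ _ (\sum_(i < N.+1) (s / (2 * N.+1%:R)) `^ p)).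
    by rewrite sumr_const card_ord mulr_natl.
  rewrite -[leLHS]add0r; apply: lerD; first by apply: sumr_ge0 => i _; exact: powR_ge0.
  apply: ler_sum => i _; apply: powR_le; [exact: ltW|by rewrite divr_ge0|].
  apply: ler_pM => //.
    apply: (@ler_sum_widen _ A) => //; lia.
  rewrite lef_pV2 ?posrE -?natrM ?ltr0n// ler_nat; have := ltn_ord i; lia.
have NE : (N.+1%:R : R) `^ (1 - p^-1) `^ p = N.+1%:R `^ p / N.+1%:R.
  rewrite -powRrM mulrBl mulVf ?mul1r; last by lra.
  by rewrite powRB ?powRr1//; apply/implyP.
rewrite [leRHS]powRM ?mulr_ge0 ?powR_ge0// NE powRM// mulrA ler_pdivlMr//.
have sE : s = (s / (2 * N.+1%:R)) * (2 * N.+1%:R) by field; rewrite addrC natr1 pnatr_eq0.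
have sp : s `^ p = (s / (2 * N.+1%:R)) `^ p * (2 `^ p * N.+1%:R `^ p).
  by rewrite -(@powRM _ 2)// -powRM ?divr_ge0// -sE.
rewrite sp; set x := (s / _) `^ p in h *; set y := 2 `^ p; set z := N.+1%:R `^ p.
have -> : x * (y * z) * N.+1%:R = N.+1%:R * x * (y * z) by ring.
have -> : y * M `^ p * z = M `^ p * (y * z) by ring.
by apply: ler_wpM2r => //; rewrite mulr_ge0 ?powR_ge0.
Qed.

End Cesaro.

(** * The lower bound for the norm of a multiplier *)

Section Key.
Context {R : realType}.
Implicit Types (p : R).

Lemma harmonic_unbounded (K : R) : ~ (forall L, \sum_(u < L) (u.+1%:R : R)^-1 <= K).
Proof.
move=> hK; apply: (@dvg_harmonic R); apply: nondecreasing_is_cvgn.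
  apply/nondecreasing_seqP => n; rewrite /series/= big_nat_recr//= lerDl.
  by rewrite invr_ge0.
by exists K => _ [n _ <-]; rewrite /series/= big_mkord; exact: hK.
Qed.

(** The right side is exp(-p ln(1 + E/x)); apply 1 + y <= exp y and ln(1 + y) <= y. *)
Lemma powR_ratio_ge p (x E : R) : 0 < p -> 0 < x -> 0 <= E ->
  1 - p * E / x <= (x / (x + E)) `^ p.
Proof.
move=> p0 x0 E0; have xE : 0 < x / (x + E) by rewrite divr_gt0//; lra.
rewrite /powR gt_eqF//; apply: le_trans (expR_ge1Dx _).
have -> : x / (x + E) = (1 + E / x)^-1 by field; rewrite !gt_eqF//; lra.
rewrite lnV; last by rewrite posrE ltr_wpDr// divr_ge0// ltW.
have : ln (1 + E / x) <= E / x.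
  by apply: le_ln1Dx; apply: lt_le_trans (_ : 0 <= _); rewrite ?divr_ge0// ltW.
by rewrite -mulrA; nra.
Qed.

(** By [powR_ratio_ge] the sum on the left differs from the harmonic sum by a bounded amount. As
    harmonic sums are unbounded, the leading coefficients T^p and M^p can be compared. *)
Lemma harmonic_comparison p (T M K E : R) :
  1 < p -> 0 <= T -> 0 <= M -> 0 <= E ->
  (forall L, T `^ p * \sum_(u < L) (u.+1%:R `^ (p - 1) / (u.+1%:R + E) `^ p) <=
             M `^ p * (\sum_(u < L) u.+1%:R^-1 + K)) -> T <= M.
Proof.
move=> p1 T0 M0 E0 hL; have p0 : 0 < p by lra.
apply: (powR_le_inv p0) => //; rewrite leNgt; apply/negP => MT.
have [Z Z0 hZ] := @zeta_bounded R 2 ltac:(lra).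
(* This constant solves T^p (H - p E Z) <= M^p (H + K) for the harmonic sum H. *)
apply: (@harmonic_unbounded ((M `^ p * K + T `^ p * (p * E * Z)) / (T `^ p - M `^ p))).
move=> L; rewrite ler_pdivlMr; last by lra.
have {}hL := hL L; have {}hZ := hZ L.
have : \sum_(u < L) u.+1%:R^-1 - p * E * Z <=
    \sum_(u < L) (u.+1%:R `^ (p - 1) / (u.+1%:R + E) `^ p).
  apply: (@le_trans _ _ (\sum_(u < L) (u.+1%:R^-1 - p * E * u.+1%:R `^ (- 2%:R)))).
    rewrite sumrB -mulr_sumr lerB// ler_wpM2l// mulr_ge0//; exact: ltW.
  apply: ler_sum => u _.
  have x0 : (0 : R) < u.+1%:R by [].
  move: (u.+1%:R : R) x0 => x x0.
  have -> : x `^ (p - 1) / (x + E) `^ p = x^-1 * (x / (x + E)) `^ p.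
    rewrite powRM; [|exact: ltW|by rewrite invr_ge0; lra].
    rewrite powRB ?powRr1; [|exact: ltW|by rewrite (gt_eqF x0) implybT].
    by rewrite -powR_mulN ?powRN; [ring|lra].
  rewrite powR_invn ?(ltW x0)//.
  have -> : x^-1 - p * E * x ^- 2 = x^-1 * (1 - p * E / x) by field; rewrite gt_eqF.
  rewrite ler_pM2l ?invr_gt0//; exact: powR_ratio_ge.
have := powR_ge0 T p; have := powR_ge0 M p.
nra.
Qed.

(* Partial sums j^r are the borderline growth for ces_p; they are cut off at L. *)
Definition profile (r : R) (L j : nat) : R :=
  (minn j.+1 L)%:R `^ r - (minn j L)%:R `^ r.

Lemma profile_ge0 (r : R) L j : 0 <= r -> 0 <= profile r L j.
Proof.
by move=> r0; rewrite subr_ge0 powR_le// ler_nat; lia.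
Qed.

Lemma sum_profile (r : R) L n : 0 < r ->
  \sum_(j < n) profile r L j = (minn n L)%:R `^ r.
Proof.
move=> r0; rewrite -(big_mkord predT) telescope_sumr// min0n.
by rewrite powR0 ?subr0// gt_eqF.
Qed.

(** With r = 1 - 1/p one has r p = p - 1. Below the cut-off the terms n^{rp} / n^p are exactly 1/n;
    from there on they are L^{p-1} n^{-p}, whose sum is bounded uniformly in L. *)
Lemma ces_sum_profile p : 1 < p -> exists2 Z : R, 0 <= Z & forall L X, (0 < L)%N ->
  ces_sum p X (profile (1 - p^-1) L) <= \sum_(u < L) u.+1%:R^-1 + Z.
Proof.
move=> p1; have [Z Z0 hZ] := @zeta_bounded R p p1; exists Z => // L X L0.
have p0 : 0 < p by lra.
have r0 : 0 < 1 - p^-1 by rewrite subr_gt0 invf_lt1.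
have rp (x : R) : 0 <= x -> x `^ (1 - p^-1) `^ p = x `^ (p - 1).
  by move=> x0; rewrite -powRrM mulrBl mulVf ?mul1r// gt_eqF.
(* [I (n %/ L)] is the indicator of [L <= n], so [block_sum] applied to [I] bounds the tail of the
   zeta series by L^{1-p} times a constant. *)
pose I (j : nat) : R := (0 < j)%:R.
have head : \sum_(n < X | (n < L)%N) (n.+1%:R : R)^-1 <= \sum_(u < L) u.+1%:R^-1.
  have [XL|LX] := leqP X L.
    rewrite (eq_bigl predT); last by move=> n; rewrite (leq_trans (ltn_ord n)).
    by apply: (@ler_sum_widen _ (fun u => u.+1%:R^-1)).
  by rewrite -(big_ord_widen X (fun u => (u.+1%:R : R)^-1))// ltnW.
have tail : L%:R `^ (p - 1) * \sum_(n < X) (I (n.+1 %/ L)%N / n.+1%:R) `^ p <= Z.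
  have := @block_sum _ p X L I p1 L0 erefl (fun j => ler0n _ _).
  rewrite -(opprB p 1) powRN => /(ler_wpM2l (powR_ge0 L%:R (p - 1))).
  move=> /le_trans; apply; rewrite mulrA mulfV ?mul1r; last first.
    by rewrite gt_eqF// powR_gt0// ltr0n.
  apply: le_trans (hZ X); rewrite le_eqVlt; apply/orP; left; apply/eqP.
  by apply: eq_bigr => j _; rewrite /I /= mul1r powR_mulN.
rewrite mulr_sumr in tail.
apply: le_trans (lerD head tail).
rewrite big_mkcond -big_split/=; apply: ler_sum => n _.
rewrite sum_profile//; have [nL|Ln] := ltnP n L.
  rewrite (minn_idPl nL) powRM ?powR_ge0// rp// powRB; last by rewrite pnatr_eq0 implybT.
  rewrite powRr1// -powR_mulN// powRN mulrAC mulfV ?mul1r ?powR_eq0 ?pnatr_eq0//.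
  by rewrite lerDl mulr_ge0 ?powR_ge0.
rewrite (minn_idPr _); last by lia.
rewrite powRM ?powR_ge0// rp// add0r ler_wpM2l ?powR_ge0//.
by rewrite /I divn_gt0// (leq_trans Ln)// mul1r.
Qed.

End Key.

(** * The real-valued modulus of complex numbers *)

Section Cabs.
Context {R : realType}.
Implicit Types z w : R[i].

Lemma normcE_cabs z : `|z| = (cabs z)%:C.
Proof. by rewrite /cabs normc_def. Qed.

Lemma cabs_ge0 z : 0 <= cabs z.
Proof. by rewrite -ler0c -normcE_cabs. Qed.

Lemma cabsM z w : cabs (z * w) = cabs z * cabs w.
Proof. by apply: complexI; rewrite rmorphM -!normcE_cabs/= normrM. Qed.

Lemma cabsD z w : cabs (z + w) <= cabs z + cabs w.
Proof. by rewrite -lecR rmorphD/= -!normcE_cabs ler_normD. Qed.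

Lemma cabsN z : cabs (- z) = cabs z.
Proof. by apply: complexI; rewrite -!normcE_cabs normrN. Qed.

Lemma cabs0 : cabs (0 : R[i]) = 0.
Proof. by apply: complexI; rewrite -normcE_cabs normr0. Qed.

Lemma cabs1 : cabs (1 : R[i]) = 1.
Proof. by apply: complexI; rewrite -normcE_cabs normr1. Qed.

Lemma cabsV z : cabs z^-1 = (cabs z)^-1.
Proof. by apply: complexI; rewrite -normcE_cabs normfV normcE_cabs fmorphV. Qed.

Lemma cabs_eq0 z : (cabs z == 0) = (z == 0).
Proof. by rewrite -[RHS]normr_eq0 normcE_cabs -(inj_eq (@complexI R)). Qed.

Lemma cabs_real (x : R) : cabs x%:C = `|x|.
Proof. by rewrite /cabs normc_def/= expr0n/= addr0 sqrtr_sqr. Qed.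

Lemma cabs_sum (I : Type) (s : seq I) (P : pred I) (F : I -> R[i]) :
  cabs (\sum_(i <- s | P i) F i) <= \sum_(i <- s | P i) cabs (F i).
Proof.
elim/big_ind2 : _ => [|x1 x2 y1 y2 h1 h2|//]; first by rewrite cabs0.
by apply: le_trans (cabsD _ _) _; exact: lerD.
Qed.

Lemma cabs_triangle_sub z w : cabs z <= cabs w + cabs (z - w).
Proof. by apply: le_trans (cabsD _ _); rewrite addrC subrK. Qed.

Lemma normr_Re_le_cabs z : `|complex.Re z| <= cabs z.
Proof. by rewrite -lecR -normcE_cabs normc_ge_Re. Qed.

Lemma normr_Im_le_cabs z : `|complex.Im z| <= cabs z.
Proof.
have := normr_Re_le_cabs (z * 'i); rewrite ReiNIm normrN => /le_trans; apply.
by rewrite cabsM [X in _ * X](_ : _ = 1) ?mulr1// /cabs normc_def/= expr0n/= add0r expr1n sqrtr1.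
Qed.

Lemma cabs_le_ReIm z : cabs z <= `|complex.Re z| + `|complex.Im z|.
Proof.
rewrite {1}[z]complexE; apply: le_trans (cabsD _ _) _.
rewrite cabsM !cabs_real [X in X * _](_ : _ = 1) ?mul1r//.
by rewrite /cabs normc_def/= expr0n/= add0r expr1n sqrtr1.
Qed.

End Cabs.

(** * Dirichlet convolution of coefficient sequences *)

Section Conv.
Context {R : realType}.
Local Notation C := (R[i]^o).
Implicit Types (a b c : nat -> C) (p M : R).

(** The codivisor is found by filtering an index range instead of by division, so that [hyperbola]
    applies. *)
Definition dconv a b (n : nat) : C :=
  \sum_(k < n.+1) \sum_(j < n.+1 | (k.+1 * j.+1 == n.+1)%N) a k * b j.

Lemma dconvDr a b c n : dconv a (fun m => b m + c m) n = dconv a b n + dconv a c n.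
Proof.
rewrite /dconv -big_split; apply: eq_bigr => k _ /=.
by rewrite -big_split; apply: eq_bigr => j _; rewrite /= mulrDr.
Qed.

Lemma dconvZr a b (t : C) n : dconv a (fun m => t * b m) n = t * dconv a b n.
Proof.
rewrite /dconv mulr_sumr; apply: eq_bigr => k _ /=.
by rewrite mulr_sumr; apply: eq_bigr => j _; rewrite mulrCA.
Qed.

Lemma dconv_agree a b c X n : (forall m, (m < X)%N -> b m = c m) ->
  (n < X)%N -> dconv a b n = dconv a c n.
Proof.
move=> bc nX; apply: eq_bigr => k _; apply: eq_bigr => j _; congr (_ * _).
by apply: bc; apply: leq_trans nX; exact: ltn_ord.
Qed.

Lemma cabs_dconv_sum a b X : \sum_(n < X) cabs (dconv a b n) <=
  \sum_(k < X) cabs (a k) * \sum_(j < X %/ k.+1) cabs (b j).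
Proof.
under [leRHS]eq_bigr => k _ do rewrite mulr_sumr.
rewrite -(hyperbola (fun k j => cabs (a k) * cabs (b j))).
apply: ler_sum => n _; apply: le_trans (cabs_sum _ _ _) _; apply: ler_sum => k _.
apply: le_trans (cabs_sum _ _ _) _; apply: ler_sum => j _.
by rewrite cabsM.
Qed.

Lemma ces_le_dconv p a b (T M : R) : 1 < p -> 0 <= M ->
  (forall X, \sum_(k < X) cabs (a k) * k.+1%:R `^ (p^-1 - 1) <= T) ->
  ces_le p (cabs \o b) M -> ces_le p (cabs \o dconv a b) (T * M).
Proof.
move=> p1 M0 aT bM.
by apply: (@ces_le_conv _ p (cabs \o a) (cabs \o b)) => //= n;
  rewrite ?cabs_ge0//; exact: cabs_dconv_sum.
Qed.

End Conv.

(** * Test sequences and their convolutions *)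

Section Test.
Context {R : realType}.
Local Notation C := (R[i]^o).
Implicit Types (a b c : nat -> C) (p M : R).

(* As coefficients are indexed from 0, [N * j.+1] stands for the integer
   N (j + 1) + 1. *)
Definition test_seq (w : nat -> R) N L (n : nat) : C :=
  \sum_(j < L | n == (N * j.+1)%N) (w j)%:C.

Lemma test_seq_at (w : nat -> R) N L j : (0 < N)%N -> (j < L)%N ->
  test_seq w N L (N * j.+1) = (w j)%:C.
Proof.
move=> N0 jL; rewrite /test_seq (big_pred1 (Ordinal jL))// => i /=.
by rewrite eqn_pmul2l// eqSS eq_sym.
Qed.

Lemma test_seq_out (w : nat -> R) N L n :
  (forall j, (j < L)%N -> n != N * j.+1)%N -> test_seq w N L n = 0.
Proof.
by move=> h; rewrite /test_seq big1// => j /eqP E; have := h j (ltn_ord j); rewrite -E eqxx.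
Qed.

(** The condition [N * j.+1 < X] implies [j < X %/ N]. This puts the partial sums into the form
    required by [block_sum]. *)
Lemma cabs_test_seq_sum (w : nat -> R) N L X : (0 < N)%N -> (forall j, 0 <= w j) ->
  \sum_(n < X) cabs (test_seq w N L n) <= \sum_(j < X %/ N) w j.
Proof.
move=> N0 w0.
apply: (@le_trans _ _ (\sum_(n < X) \sum_(j < L | val n == (N * j.+1)%N) w j)).
  apply: ler_sum => n _; apply: le_trans (cabs_sum _ _ _) _.
  by apply: ler_sum => j _; rewrite cabs_real ger0_norm.
under eq_bigr => n _ do rewrite big_mkcond.
rewrite exchange_big/=.
apply: (@le_trans _ _ (\sum_(j < L | (j < X %/ N)%N) w j)); last first.
  have [LX|XL] := leqP L (X %/ N).
    rewrite [leLHS](eq_bigl predT); last by move=> n; rewrite (leq_trans (ltn_ord n) LX).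
    exact: ler_sum_widen.
  by rewrite -(big_ord_widen L w)// ltnW.
rewrite [leRHS]big_mkcond; apply: ler_sum => j _; rewrite -big_mkcond/=.
have [XN|] := ltnP (N * j.+1) X; last first.
  move=> XN; rewrite big1; first by case: ifP.
  by move=> i /eqP E; have := ltn_ord i; lia.
rewrite (big_pred1 (Ordinal XN))// leq_divRL// mulnC.
by rewrite (ltnW XN).
Qed.

(** By [test_factor_unique] only one factorization meets the support of the test sequence. The
    predecessor turns an integer into its index. *)
Lemma dconv_test_seq a (w : nat -> R) D L N k j : (0 < N)%N -> (D * L < N)%N ->
  (k < D)%N -> (j < L)%N ->
  dconv a (test_seq w N L) (k.+1 * (N * j.+1).+1).-1 = a k * (w j)%:C.
Proof.
move=> N0 DLN kD jL; set n := (_ * _).-1.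
have nE : n.+1 = (k.+1 * (N * j.+1).+1)%N by rewrite /n; nia.
have kn : (k < n.+1)%N by rewrite nE; nia.
have jn : (N * j.+1 < n.+1)%N by rewrite nE; nia.
rewrite /dconv (bigD1 (Ordinal kn))//= (bigD1 (Ordinal jn))/=; last by rewrite nE.
have uniq (k' i : nat) : (k'.+1 * i.+1 == n.+1)%N ->
    test_seq w N L i = 0 \/ (k' = k /\ i = (N * j.+1)%N).
  move=> /eqP E; have [[j' j'L iE]|] := pselect (exists2 j', (j' < L)%N & i = (N * j'.+1)%N).
    right; have := @test_factor_unique D L N k.+1 j.+1 k'.+1 j'.+1.
    case; try lia.
  move=> h; left; apply: test_seq_out => j' j'L; apply/eqP => iE.
  by apply: h; exists j'.
rewrite test_seq_at// big1 ?addr0; last first.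
  move=> i /andP[/uniq[->|[_ iE]]]; first by rewrite mulr0.
  by move=> /eqP[]; exact: val_inj.
rewrite big1 ?addr0// => k' k'k; rewrite big1// => i /uniq[->|[kE _]].
  by rewrite mulr0.
by move: k'k => /eqP[]; exact: val_inj.
Qed.

End Test.

(** * Norm bounds on convolution control the weighted sums *)

Section LowerBound.
Context {R : realType}.
Local Notation C := (R[i]^o).
Implicit Types (a b c : nat -> C) (p M : R).

(** The pairs with [k.+1 * j.+1 <= t] are sent injectively by [h] to indices below [Y] where the
    coefficient is known; all other coefficients are dropped. *)
Lemma dconv_test_seq_sum a (w : nat -> R) D L N t Y :
  (forall j, 0 <= w j) -> (D * L < N)%N -> (t <= L)%N -> (N * t + D <= Y)%N ->
  \sum_(k < D) cabs (a k) * \sum_(j < t %/ k.+1) w j <=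
  \sum_(n < Y) cabs (dconv a (test_seq w N L) n).
Proof.
move=> w0 DLN tL; case: Y => [|Y] NtY.
  have -> : D = 0%N by lia.
  by rewrite !big_ord0.
have N0 : (0 < N)%N by lia.
pose A := [set x : 'I_D * 'I_L | (x.1.+1 * x.2.+1 <= t)%N]%SET.
pose h (x : 'I_D * 'I_L) : 'I_Y.+1 := inord (x.1.+1 * (N * x.2.+1).+1).-1.
have hE x : x \in A -> (h x : nat) = (x.1.+1 * (N * x.2.+1).+1).-1.
  rewrite inE => xt; rewrite /h inordK//.
  (* The integer in question is N (k+1)(j+1) + (k+1), at most N t + D. *)
  have hY (k j : nat) : (k < D)%N -> (k.+1 * j.+1 <= t)%N ->
      ((k.+1 * (N * j.+1).+1).-1 < Y.+1)%N.
    move=> kD kjt; have H : (N * (k.+1 * j.+1) <= N * t)%N by rewrite leq_mul2l kjt orbT.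
    by rewrite (mulnS k.+1 (N * j.+1)) mulnCA; lia.
  exact: hY (ltn_ord x.1) xt.
have hinj : {in A &, injective h}.
  move=> x y xA yA /(congr1 (@nat_of_ord _)); rewrite !hE// => E.
  have := @test_factor_unique D L N y.1.+1 y.2.+1 x.1.+1 x.2.+1.
  have := ltn_ord x.1; have := ltn_ord y.1; have := ltn_ord x.2; have := ltn_ord y.2.
  move=> h1 h2 h3 h4; case; try lia.
  move=> [e1] [e2]; case: x y e1 e2 {E xA yA h1 h2 h3 h4} => [x1 x2] [y1 y2] /= e1 e2.
  by congr pair; exact: val_inj.
apply: (@le_trans _ _ (\sum_(n in h @: A) cabs (dconv a (test_seq w N L) n))); last first.
  rewrite [leRHS](bigID (mem (h @: A)))/= lerDl.
  by apply: sumr_ge0 => n _; exact: cabs_ge0.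
rewrite big_imset//= (eq_bigr (fun x : 'I_D * 'I_L => cabs (a x.1) * w x.2)); last first.
  move=> x xA; rewrite hE//.
  rewrite (@dconv_test_seq _ a w D L N x.1 x.2)//.
  by rewrite cabsM cabs_real ger0_norm.
rewrite (eq_bigl (fun x : 'I_D * 'I_L => true && (x.1.+1 * x.2.+1 <= t)%N)); last first.
  by move=> x; rewrite inE.
rewrite -(pair_big_dep predT (fun (k : 'I_D) (j : 'I_L) => (k.+1 * j.+1 <= t)%N)
  (fun k j => cabs (a k) * w j))/=.
apply: ler_sum => k _; rewrite -mulr_sumr ler_wpM2l ?cabs_ge0//.
rewrite (big_ord_widen L w); last by apply: leq_trans tL; exact: leq_div.
rewrite le_eqVlt; apply/orP; left; apply/eqP; apply: eq_bigl => j.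
by rewrite leq_divRL// mulnC.
Qed.

(** Take [t = D + u.+1] in [dconv_test_seq_sum]: the shift by [D] absorbs the rounding, since (k+1)
    times the quotient of t by k+1 is at least t - k >= u + 1. As [t <= L], the cut-off of the
    profile is not reached. *)
Lemma dconv_profile_sum a r D L N u Y :
  0 < r -> (D * L < N)%N -> (D + u < L)%N ->
  (N * (D + u.+1) + D <= Y)%N ->
  (\sum_(k < D) cabs (a k) * k.+1%:R `^ (- r)) * u.+1%:R `^ r <=
  \sum_(n < Y) cabs (dconv a (test_seq (profile r L) N L) n).
Proof.
move=> r0 DLN uL NY.
apply: le_trans (@dconv_test_seq_sum a (profile r L) D L N (D + u.+1) Y _ _ _ _) => //.
- rewrite mulr_suml; apply: ler_sum => k _.
  rewrite sum_profile// (minn_idPl _); last first.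
    by apply: leq_trans (leq_div _ _) _; lia.
  rewrite -mulrA ler_wpM2l ?cabs_ge0// powR_mulN// -powRM ?invr_ge0//.
  apply: powR_le; [exact: ltW|by rewrite mulr_ge0// invr_ge0|].
  rewrite mulrC ler_pdivrMr// -natrM ler_nat.
  have := divn_eq (D + u.+1) k.+1; have := ltn_pmod (D + u.+1) (ltn0Sn k).
  by have := ltn_ord k; lia.
- by move=> j; apply: profile_ge0; exact: ltW.
- by lia.
Qed.

(** Testing only on sequences that vanish below [X0] lets the gliding hump place its humps
    arbitrarily far out; the norm identity takes [X0 = 0]. *)
Lemma multiplier_bound_ge p a M X0 : 1 < p -> 0 <= M ->
  (forall c B, (forall n, (n < X0)%N -> c n = 0) -> 0 < B ->
     ces_le p (cabs \o c) B -> ces_le p (cabs \o dconv a c) (M * B)) ->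
  forall D, \sum_(k < D) cabs (a k) * k.+1%:R `^ (p^-1 - 1) <= M.
Proof.
move=> p1 M0 hM [|D']; first by rewrite big_ord0.
set D := D'.+1; set T := (X in X <= M).
have T0 : 0 <= T.
  by apply: sumr_ge0 => k _; rewrite mulr_ge0 ?powR_ge0 ?cabs_ge0.
have p0 : 0 < p by lra.
have [Z Z0 hZ] := @ces_sum_profile R p p1.
set r := 1 - p^-1 in hZ.
have r0 : 0 < r by rewrite subr_gt0 invf_lt1.
have rp (x : R) : 0 <= x -> x `^ r `^ p = x `^ (p - 1).
  by move=> x0; rewrite -powRrM mulrBl mulVf ?mul1r// gt_eqF.
(* The test sequence has length [L = D + L']: the [D] additional harmonic terms are at most 1 each,
   and [Z] comes from [ces_sum_profile]. The shift [D + 2] is that of the denominators in the blocks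
   below. *)
apply: (@harmonic_comparison _ p T M (D%:R + Z) (D + 2)%:R p1 T0 M0) => // L'.
(* [N] exceeds [D * L] to exclude coincidences, [D] to absorb an offset in the denominators, and
   [X0] to place the support. *)
pose L := (D + L')%N; pose N := (D * L + D + X0).+1.
have N0 : (0 : R) < N%:R by rewrite ltr0n.
have NDL : (D * L < N)%N by rewrite /N; lia.
have DN : (D <= N)%N by rewrite /N; lia.
have X0N : (X0 < N)%N by rewrite /N; lia.
pose W : R := \sum_(u < L) u.+1%:R^-1 + Z.
have W0 : 0 < W.
  rewrite ltr_wpDr// /L addSn big_ord_recl/= ltr_wpDr ?invr_gt0//.
  by apply: sumr_ge0 => i _; rewrite invr_ge0.
pose c := test_seq (profile r L) N L.
have w0 j : 0 <= profile r L j by apply: profile_ge0; exact: ltW.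
pose B := (N%:R `^ (1 - p) * W) `^ p^-1.
have BE : B `^ p = N%:R `^ (1 - p) * W.
  rewrite /B -powRrM mulVf ?powRr1 ?gt_eqF//.
  by rewrite mulr_ge0 ?powR_ge0// ltW.
have cB : ces_le p (cabs \o c) B.
  move=> X; rewrite BE.
  apply: (@le_trans _ _ (\sum_(n < X)
    ((\sum_(j < n.+1 %/ N) profile r L j) / n.+1%:R) `^ p)).
    apply: ler_sum => n _; apply: powR_le; first exact: ltW.
      by rewrite divr_ge0// sumr_ge0// => i _; exact: cabs_ge0.
    by rewrite ler_wpM2r//; exact: cabs_test_seq_sum.
  apply: le_trans (@block_sum _ p X N (fun m => \sum_(j < m) profile r L j) p1 _ _ _) _ => //.
  - by rewrite big_ord0.
  - by move=> m; apply: sumr_ge0.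
  by rewrite ler_wpM2l ?powR_ge0//; apply: hZ; rewrite /L.
(* The first [D'] terms and the next [D + 1] blocks of length [N] are discarded; [L'] blocks remain,
   one for each [u]. *)
have {cB} := hM c B _ _ cB ((D' + (D + 1 + L') * N))%N.
have -> : (M * B) `^ p = N%:R `^ (1 - p) * (M `^ p * W).
  by rewrite powRM ?powR_ge0// BE mulrCA.
move=> hub.
have {hub} : N%:R `^ (1 - p) * (T `^ p * \sum_(u < L')
    (u.+1%:R `^ (p - 1) / (u.+1%:R + (D + 2)%:R) `^ p)) <= N%:R `^ (1 - p) * (M `^ p * W).
  apply: le_trans (hub _ _); first last.
  - by rewrite powR_gt0// mulr_gt0// powR_gt0.
  - move=> n nX; apply: test_seq_out => j _; rewrite ltn_eqF//.
    by apply: leq_trans (ltn_trans nX X0N) _; rewrite leq_pmulr.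
  rewrite /ces_sum big_split_ord/=.
  apply: ler_wpDl; first by apply: sumr_ge0 => i _; exact: powR_ge0.
  pose F i : R := \sum_(k < i.+1) (cabs \o dconv a c) k.
  rewrite -(big_mkord predT (fun i => (F (D' + i)%N / (D' + i).+1%:R) `^ p)).
  rewrite big_nat_mul big_mkord big_split_ord/=.
  apply: ler_wpDl.
    by apply: sumr_ge0 => i _; apply: sumr_ge0 => j _; exact: powR_ge0.
  rewrite !mulr_sumr; apply: ler_sum => u _.
  (* A lower bound for every average in block [u]: the partial sums are at least T (u+1)^r by
     [dconv_profile_sum], and the denominators D + i are at most N (u + D + 3) because [D <= N]. *)
  set x : R := T * u.+1%:R `^ r / (N * (u.+1 + (D + 2)))%:R.
  have x0 : 0 <= x by rewrite /x divr_ge0// mulr_ge0 ?powR_ge0.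
  apply: (@le_trans _ _ (\sum_((D + 1 + u) * N <= i < (D + 1 + u).+1 * N) x `^ p)).
    rewrite sumr_const_nat mulSn addnK.
    rewrite /x natrM -natrD; set y : R := (u.+1 + (D + 2))%:R.
    have y0 : 0 <= y by [].
    rewrite invfM !mulrA powRM ?mulr_ge0 ?powR_ge0 ?invr_ge0//.
    rewrite powRM ?mulr_ge0 ?powR_ge0 ?invr_ge0// powRM ?powR_ge0// rp//.
    rewrite powRB; last by rewrite pnatr_eq0 implybT.
    rewrite powRr1// -!powR_mulN// !powRN -[leRHS]mulr_natr.
    by rewrite le_eqVlt; apply/orP; left; apply/eqP; ring.
  rewrite [leLHS]big_nat [leRHS]big_nat; apply: ler_sum => i /andP[i1 i2].
  apply: powR_le => //; first exact: ltW.
  rewrite /x; apply: ler_pM; rewrite ?mulr_ge0 ?powR_ge0 ?invr_ge0//.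
    rewrite /F /T.
    have := @dconv_profile_sum a r D L N u (D' + i).+1 r0.
    have -> : p^-1 - 1 = - r by rewrite /r opprB.
    apply => //; first by rewrite ltn_add2l.
    have -> : (D + u.+1 = D + 1 + u)%N by rewrite addnS addn1.
    by rewrite mulnC -addSn addnC leq_add2l.
  rewrite lef_pV2 ?posrE ?ltr0n ?muln_gt0// ler_nat.
  have -> : (u.+1 + (D + 2) = (D + 1 + u).+1.+1)%N.
    by rewrite addn1 addn2 !addnS !addSn addnC.
  by rewrite mulnC mulSn -addSn leq_add// ltnW.
rewrite ler_pM2l ?powR_gt0// => /le_trans; apply.
rewrite ler_wpM2l ?powR_ge0// /W addrA lerD2r /L addnC big_split_ord/= lerD2l.
apply: (@le_trans _ _ (\sum_(i < D) 1)); last by rewrite sumr_const card_ord.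
by apply: ler_sum => i _; rewrite invf_le1// ler1n.
Qed.

End LowerBound.

(** * The gliding hump *)

Section GlidingHump.
Context {R : realType}.
Local Notation C := (R[i]^o).
Implicit Types (a b c g h : nat -> C) (p M : R).

Lemma ces_le_cabsZ p c (t M : R) : 0 <= t -> 0 <= M ->
  ces_le p (cabs \o c) M -> ces_le p (cabs \o (fun n => t%:C * c n)) (t * M).
Proof.
move=> t0 M0 cM; rewrite (_ : _ \o _ = fun n => t * cabs (c n)).
  by apply: (@ces_leZ _ p (cabs \o c)) => // n; exact: cabs_ge0.
by apply/funext => n /=; rewrite cabsM cabs_real ger0_norm.
Qed.

(* If the norm of a * (g + h) were at most K for all small h, then that of a * h
   also would be, because 2 a * h = a * (g + h) - a * (g - h). *)
Lemma hump_step p a g X (eps K : R) : 1 < p ->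
  (~ exists T, forall D, \sum_(k < D) cabs (a k) * k.+1%:R `^ (p^-1 - 1) <= T) ->
  0 < eps -> 0 <= K ->
  exists hY : (nat -> C) * nat, [/\ forall n, (n < X)%N -> hY.1 n = 0,
    ces_le p (cabs \o hY.1) eps &
    K `^ p < ces_sum p hY.2 (cabs \o dconv a (fun n => g n + hY.1 n))].
Proof.
move=> p1 aT eps0 K0; apply: contrapT => nex; apply: aT.
have hub h : (forall n, (n < X)%N -> h n = 0) -> ces_le p (cabs \o h) eps ->
    ces_le p (cabs \o dconv a (fun n => g n + h n)) K.
  move=> hX heps Y; rewrite leNgt; apply/negP => KY; apply: nex.
  by exists (h, Y).
have hub2 h : (forall n, (n < X)%N -> h n = 0) -> ces_le p (cabs \o h) eps ->
    ces_le p (cabs \o dconv a h) K.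
  move=> hX heps; have hp := hub h hX heps.
  have hm : ces_le p (cabs \o dconv a (fun n => g n + - 1 * h n)) K.
    apply: hub => [n nX|]; first by rewrite hX// mulr0.
    by rewrite (_ : _ \o _ = cabs \o h)//; apply/funext => n /=; rewrite mulN1r cabsN.
  have H : ces_le p (fun n => 2 * cabs (dconv a h n)) (K + K).
    apply: (ces_leD p1 K0 K0 _ _ _ _ hp hm) => n; rewrite ?mulr_ge0 ?cabs_ge0//=.
    rewrite !dconvDr dconvZr mulN1r -[X in X + _]cabsN.
    apply: le_trans (_ : _ <= cabs (- (2 * dconv a h n))) _.
      by rewrite cabsN cabsM (_ : cabs 2 = 2)// -(rmorph_nat (real_complex R)) cabs_real ger0_norm.
    rewrite (_ : - (2 * _) = - (dconv a g n + dconv a h n) + (dconv a g n - dconv a h n)).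
      exact: cabsD.
    by ring.
  have := @ces_leZ _ p (fun n => 2 * cabs (dconv a h n)) 2^-1 (K + K).
  rewrite (_ : 2^-1 * (K + K) = K); last by field.
  rewrite (_ : (fun n => 2^-1 * (2 * _)) = cabs \o dconv a h); last first.
    by apply/funext => n /=; field.
  by apply=> //; [lra|move=> n; rewrite mulr_ge0 ?cabs_ge0].
(* Scaling a sequence of norm at most [B] by [eps / B] makes [hub2] applicable; scaling back gives
   the bound [K / eps * B]. *)
exists (K / eps); apply: (multiplier_bound_ge (X0 := X)) => //.
  by rewrite divr_ge0// ltW.
move=> c B cX B0 cB.
have eB : 0 <= eps / B by rewrite divr_ge0// ltW.
have Be : 0 <= B / eps by rewrite divr_ge0// ltW.
have H : ces_le p (cabs \o (fun n => (eps / B)%:C * dconv a c n)) K.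
  rewrite (_ : (fun n => _) = dconv a (fun n => (eps / B)%:C * c n)); last first.
    by apply/funext => n; rewrite dconvZr.
  apply: hub2; first by move=> n nX; rewrite cX// mulr0.
  by have := ces_le_cabsZ eB (ltW B0) cB; rewrite divfK ?gt_eqF.
have := ces_le_cabsZ Be K0 H.
rewrite (_ : B / eps * K = K / eps * B); last by ring.
rewrite (_ : (fun n => (B / eps)%:C * _) = dconv a c)//; apply/funext => n.
rewrite mulrA -rmorphM (_ : B / eps * (eps / B) = 1) ?mul1r//.
by field; rewrite !gt_eqF.
Qed.

Lemma gliding_hump p a : 1 < p ->
  (~ exists T, forall D, \sum_(k < D) cabs (a k) * k.+1%:R `^ (p^-1 - 1) <= T) ->
  exists2 c, ces_le p (cabs \o c) 1 &
    forall K, 0 <= K -> ~ ces_le p (cabs \o dconv a c) K.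
Proof.
move=> p1 aT; have p0 : 0 < p by lra.
(* The hump sizes sum to 1, the norm bound for the limit. *)
pose eps i : R := 2^-1 ^+ i.+1.
have eps0 i : 0 < eps i by rewrite exprn_gt0// invr_gt0.
have [F hF] : {F : nat * ((nat -> C) * nat) -> (nat -> C) * nat & forall s,
    [/\ forall n, (n < s.2.2)%N -> (F s).1 n = 0,
      ces_le p (cabs \o (F s).1) (eps s.1) &
      s.1%:R `^ p < ces_sum p (F s).2 (cabs \o dconv a (fun n => s.2.1 n + (F s).1 n))]}.
  apply: (@choice _ _ (fun s hY => [/\ forall n, (n < s.2.2)%N -> hY.1 n = 0,
      ces_le p (cabs \o hY.1) (eps s.1) &
      s.1%:R `^ p < ces_sum p hY.2 (cabs \o dconv a (fun n => s.2.1 n + hY.1 n))])).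
  by move=> s; exact: hump_step.
(* The new bound covers the range on which the i-th hump makes the convolution large, and it
   strictly increases, so that every coefficient is eventually fixed. *)
pose step i s := let hY := F (i, s) in
  ((fun n => s.1 n + hY.1 n) : nat -> C, maxn hY.2 s.2.+1).
(* [(st i).2] is a bound below which the coefficients are no longer changed. *)
pose st := fix st i := if i is i'.+1 then step i' (st i') else ((fun=> 0) : nat -> C, 0%N).
have stX i j : (i <= j)%N -> ((st i).2 <= (st j).2)%N.
  elim: j => [|j IH]; first by rewrite leqn0 => /eqP ->.
  rewrite leq_eqVlt => /predU1P[->//|/IH /leq_trans]; apply.
  by rewrite /= leq_max leqnSn orbT.
have iX i : (i <= (st i).2)%N.
  by elim: i => // i IH; rewrite /= leq_max ltnS IH orbT.
have stg i j n : (i <= j)%N -> (n < (st i).2)%N -> (st j).1 n = (st i).1 n.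
  elim: j => [|j IH]; first by rewrite leqn0 => /eqP ->.
  rewrite leq_eqVlt => /predU1P[->//|ij nX] /=.
  have [h0 _ _] := hF (j, st j).
  by rewrite h0 ?addr0 ?IH//=; apply: leq_trans nX (stX _ _ _).
have stle i : ces_le p (cabs \o (st i).1) (1 - 2^-1 ^+ i).
  elim: i => [|i IH].
    rewrite expr0 subrr => X /=; rewrite powR0 ?gt_eqF// /ces_sum big1// => n _.
    by rewrite big1 ?mul0r ?powR0 ?gt_eqF// => k _; rewrite /= cabs0.
  have [_ h _] := hF (i, st i).
  have -> : 1 - 2^-1 ^+ i.+1 = 1 - 2^-1 ^+ i + eps i :> R.
    by rewrite /eps exprS; field.
  apply: (@ces_leD _ p (cabs \o (st i).1) (cabs \o (F (i, st i)).1)) => //.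
  - by rewrite subr_ge0 exprn_ile1//; lra.
  - exact: ltW.
  - by move=> n; exact: cabs_ge0.
  - by move=> n; exact: cabs_ge0.
  - by move=> n; exact: cabs_ge0.
  - by move=> n; exact: cabsD.
(* Coefficient [n] is final at stage [n.+1], since [n < (st n.+1).2] by [iX]. *)
pose c n := (st n.+1).1 n.
have cE i n : (n < (st i).2)%N -> c n = (st i).1 n.
  move=> nX; rewrite /c; have [ni|/ltnW ni] := leqP n.+1 i.
    by rewrite -(stg _ _ _ ni)//; exact: iX.
  by rewrite (stg _ _ _ ni).
exists c.
  move=> X; rewrite (_ : ces_sum _ _ _ = ces_sum p X (cabs \o (st X).1)); last first.
    apply: eq_bigr => n _; congr ((_ / _) `^ _); apply: eq_bigr => k _ /=.
    rewrite (cE X)//; apply: leq_trans (iX X); apply: leq_trans (ltn_ord k) _.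
    exact: ltn_ord.
  apply: le_trans (stle X X) _; apply: powR_le; first exact: ltW.
    by rewrite subr_ge0 exprn_ile1//; lra.
  by rewrite gerBl exprn_ge0.
move=> K K0 cK; pose i := (Num.truncn K).+1.
have Ki : K <= i%:R by apply: ltW; exact: truncnS_gt.
have [_ _ hi] := hF (i, st i).
(* Below [(st i.+1).2] the convolution involves only final coefficients, so that [c] may be replaced
   by stage [i.+1], where the sum exceeds i^p >= K^p. *)
have : ces_sum p (st i.+1).2 (cabs \o dconv a (st i.+1).1) <= K `^ p.
  rewrite (_ : ces_sum _ _ _ = ces_sum p (st i.+1).2 (cabs \o dconv a c)); first exact: cK.
  apply: eq_bigr => n _; congr ((_ / _) `^ _); apply: eq_bigr => k _ /=.
  congr cabs; apply: (@dconv_agree _ _ _ _ (st i.+1).2).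
    by move=> m mX; rewrite (cE i.+1).
  by apply: leq_trans (ltn_ord k) _; exact: ltn_ord.
apply/negP; rewrite -ltNge; apply: le_lt_trans (powR_le (ltW p0) K0 Ki) _.
apply: lt_le_trans hi _; apply: ces_sum_widen.
by rewrite /= leq_maxl.
Qed.

End GlidingHump.

(** * Dirichlet series *)

Section Bridge.
Context {R : realType}.
Local Notation C := (R[i]^o).
Implicit Types (a b c : nat -> C) (p M : R).

Lemma nneseries_leP (u : nat -> R) (M : R) : (forall n, 0 <= u n) ->
  (\sum_(n <oo) (u n)%:E <= M%:E)%E <-> forall X, \sum_(n < X) u n <= M.
Proof.
move=> u0; split=> [h X|h].
  rewrite -lee_fin -(big_mkord predT) -sumEFin; apply: le_trans h.
  by apply: nneseries_lim_ge => n _ _; rewrite lee_fin.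
apply: lime_le; first by apply: is_cvg_nneseries => n _ _; rewrite lee_fin.
by apply: nearW => X; rewrite sumEFin lee_fin big_mkord.
Qed.

Lemma ces_norm_leP p a M : 1 < p -> 0 <= M ->
  (ces_norm p a <= M%:E)%E <-> ces_le p (cabs \o a) M.
Proof.
move=> p1 M0; have p0 : 0 < p by lra.
pose u n : R := (n.+1%:R^-1 * \sum_(k < n.+1) cabs (a k)) `^ p.
have -> : ces_norm p a = ((\sum_(n <oo) (u n)%:E) `^ p^-1)%E by [].
have uE n : u n = ((\sum_(k < n.+1) cabs (a k)) / n.+1%:R) `^ p by rewrite /u mulrC.
have u0 n : 0 <= u n by exact: powR_ge0.
have sE X : ces_sum p X (cabs \o a) = \sum_(n < X) u n.
  by apply: eq_bigr => n _; rewrite uE.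
suff : ((\sum_(n <oo) (u n)%:E) `^ p^-1 <= M%:E)%E <->
    (\sum_(n <oo) (u n)%:E <= (M `^ p)%:E)%E.
  move=> ->; rewrite nneseries_leP//.
  by split=> h X; have := h X; rewrite sE.
have : (0 <= \sum_(n <oo) (u n)%:E)%E.
  by apply: nneseries_ge0 => n _ _; rewrite lee_fin.
case: (\sum_(n <oo) _)%E => [x| |]//.
  rewrite poweR_EFin !lee_fin => x0.
  have xE : (x `^ p^-1) `^ p = x by rewrite -powRrM mulVf ?powRr1// gt_eqF.
  split=> [h|h]; first by rewrite -xE; apply: powR_le => //; [exact: ltW|exact: powR_ge0].
  by apply: (powR_le_inv p0); rewrite ?powR_ge0// xE.
by rewrite poweRyr ?invr_neq0 ?gt_eqF.
Qed.

Lemma ces_norm_ge0 p a : (0 <= ces_norm p a)%E.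
Proof. exact: poweR_ge0. Qed.

Lemma cesP p a : 1 < p -> ces p a <-> exists2 M, 0 <= M & ces_le p (cabs \o a) M.
Proof.
move=> p1; split=> [|[M M0 /(ces_norm_leP _ p1 M0) h]].
  rewrite /ces/=; have := ces_norm_ge0 p a; case E: (ces_norm p a) => [x| |]//.
  rewrite lee_fin => x0 _; exists x => //; apply/ces_norm_leP => //.
  by rewrite E.
by apply: le_lt_trans h _; exact: ltry.
Qed.

Lemma weighted_l1_leP r a M : (weighted_l1_norm r a <= M%:E)%E <->
  forall X, \sum_(n < X) cabs (a n) * n.+1%:R `^ (- r) <= M.
Proof.
by apply: nneseries_leP => n; rewrite mulr_ge0 ?powR_ge0 ?cabs_ge0.
Qed.

Lemma weighted_l1_fin r a : (weighted_l1_norm r a < +oo)%E <->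
  exists T, forall X, \sum_(n < X) cabs (a n) * n.+1%:R `^ (- r) <= T.
Proof.
split=> [|[T /weighted_l1_leP h]]; last by apply: le_lt_trans h _; exact: ltry.
have : (0 <= weighted_l1_norm r a)%E.
  by apply: nneseries_ge0 => n _ _; rewrite lee_fin mulr_ge0 ?powR_ge0 ?cabs_ge0.
case E: (weighted_l1_norm r a) => [x| |]// _ _; exists x; apply/weighted_l1_leP.
by rewrite E.
Qed.

End Bridge.

(** * Convergence of complex sequences and series *)

Section ComplexSeq.
Context {R : realType}.
Local Notation C := (R[i]^o).
Implicit Types (u v : nat -> C) (l : C).

(** The norm on [C] has values in [R[i]], and so do the radii; a positive element of [R[i]] is real,
    so real radii suffice. *)
Lemma ccvgP u l : (u @ \oo --> l) <->
  forall e : R, 0 < e -> exists N, forall n, (N <= n)%N -> cabs (u n - l) <= e.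
Proof.
split=> [/cvgrPdist_le h e e0|h].
  have /h[N _ hN] : 0 < e%:C by rewrite ltcR.
  exists N => n /hN /=; rewrite normcE_cabs lecR => h1.
  by rewrite -cabsN opprB.
apply/cvgrPdist_le => e e0.
have eE : e = (complex.Re e)%:C by rewrite RRe_real// ger0_real// ltW.
have /h[N hN] : 0 < complex.Re e by rewrite -ltcR -eE.
exists N => // n /hN h1 /=; rewrite eE normcE_cabs lecR.
by rewrite -cabsN opprB.
Qed.

Lemma real_abs_series_cvg (x : nat -> R) (K : R) :
  (forall X, \sum_(n < X) `|x n| <= K) -> exists l : R, series x @ \oo --> l.
Proof.
move=> xK; suff /cvg_ex[l hl] : cvgn (series x) by exists l.
apply: normed_cvg; apply: nondecreasing_is_cvgn.
  by apply: nondecreasing_series => n _ _; exact: normr_ge0.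
by exists K => _ [n _ <-]; have := xK n; rewrite -(big_mkord predT (fun n => `|x n|)).
Qed.

Lemma Re_sum (I : Type) (s : seq I) (F : I -> R[i]) :
  complex.Re (\sum_(i <- s) F i) = \sum_(i <- s) complex.Re (F i).
Proof. by apply: (big_morph (@complex.Re R)) => // -[? ?] [? ?]. Qed.

Lemma Im_sum (I : Type) (s : seq I) (F : I -> R[i]) :
  complex.Im (\sum_(i <- s) F i) = \sum_(i <- s) complex.Im (F i).
Proof. by apply: (big_morph (@complex.Im R)) => // -[? ?] [? ?]. Qed.

Lemma ReB z w : complex.Re (z - w : R[i]) = complex.Re z - complex.Re w.
Proof. by case: z w => [? ?] [? ?]. Qed.

Lemma ImB z w : complex.Im (z - w : R[i]) = complex.Im z - complex.Im w.
Proof. by case: z w => [? ?] [? ?]. Qed.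

Lemma abs_series_cvg u (K : R) :
  (forall X, \sum_(n < X) cabs (u n) <= K) -> exists l : C, series u @ \oo --> l.
Proof.
move=> uK.
have [x hx] : exists l : R, series (fun n => complex.Re (u n)) @ \oo --> l.
  apply: (@real_abs_series_cvg _ K) => X; apply: le_trans (uK X).
  by apply: ler_sum => n _; exact: normr_Re_le_cabs.
have [y hy] : exists l : R, series (fun n => complex.Im (u n)) @ \oo --> l.
  apply: (@real_abs_series_cvg _ K) => X; apply: le_trans (uK X).
  by apply: ler_sum => n _; exact: normr_Im_le_cabs.
exists (x +i* y); apply/ccvgP => e e0.
have e2 : 0 < e / 2 by lra.
move/cvgrPdist_le : hx => /(_ _ e2)[N1 _ h1].
move/cvgrPdist_le : hy => /(_ _ e2)[N2 _ h2].
exists (maxn N1 N2) => n; rewrite geq_max => /andP[/h1 /= n1 /h2 /= n2].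
apply: le_trans (cabs_le_ReIm _) _.
rewrite ReB ImB /= /series/= Re_sum Im_sum distrC [X in _ + X]distrC.
rewrite /series/= in n1 n2; lra.
Qed.

Lemma series_cvg_bounded u l : series u @ \oo --> l ->
  exists2 K : R, 0 <= K & forall n, cabs (series u n) <= K.
Proof.
move=> /ccvgP /(_ 1 ltr01)[N hN].
exists (\sum_(n < N) cabs (series u n) + (cabs l + 1)).
  by rewrite !addr_ge0 ?cabs_ge0// sumr_ge0// => i _; exact: cabs_ge0.
move=> n; have [nN|Nn] := ltnP n N.
  rewrite (bigD1 (Ordinal nN))//= -addrA lerDl !addr_ge0 ?cabs_ge0//.
  by apply: sumr_ge0 => i _; exact: cabs_ge0.
apply: ler_wpDl; first by apply: sumr_ge0 => i _; exact: cabs_ge0.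
by apply: le_trans (cabs_triangle_sub _ l) _; rewrite lerD2l hN.
Qed.

End ComplexSeq.

(** * The functions n^{-s} *)

Section Dpow.
Context {R : realType}.
Implicit Types z w s : R[i].

Lemma cexpD z w : cexp (z + w) = cexp z * cexp w.
Proof.
case: z w => [a b] [c d]; rewrite /cexp/= expRD cosD sinD.
by apply/eqP; rewrite eq_complex/=; apply/andP; split; apply/eqP; ring.
Qed.

Lemma cabs_cexp z : cabs (cexp z) = expR (complex.Re z).
Proof.
rewrite /cexp cabsM cabs_real ger0_norm ?expR_ge0//.
by rewrite /cabs normc_def/= cos2Dsin2 sqrtr1 mulr1.
Qed.

Lemma dpow1 s : dpow 1 s = 1.
Proof.
rewrite /dpow ln1 mulr0 /cexp/= expR0 cos0 sin0.
by apply/eqP; rewrite eq_complex/=; apply/andP; split; apply/eqP; ring.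
Qed.

Lemma dpowM m n s : dpow (m.+1 * n.+1) s = dpow m.+1 s * dpow n.+1 s.
Proof.
by rewrite /dpow -cexpD natrM lnM ?posrE// rmorphD/= mulrDr.
Qed.

Lemma cabs_dpow n s : cabs (dpow n.+1 s) = n.+1%:R `^ (- complex.Re s).
Proof.
rewrite /dpow cabs_cexp /powR pnatr_eq0/=; congr expR.
by case: s => a b /=; ring.
Qed.

Lemma dpowD n s h : dpow n (s + h) = dpow n s * cexp (- h * (ln n%:R)%:C).
Proof. by rewrite /dpow -cexpD -mulrDl opprD. Qed.

End Dpow.

(** * Growth and uniqueness of the coefficients *)

Section DirichletTheory.
Context {R : realType}.
Local Notation C := (R[i]^o).
Implicit Types (a b c : nat -> C) (f g : C -> C) (theta : R).

(** The terms of the convergent series at [theta + 1] are bounded, being differences of bounded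
    partial sums. *)
Lemma dirichlet_coef_growth theta a f : dirichlet_on theta a f ->
  exists K : R, forall n, cabs (a n) <= K * n.+1%:R `^ (theta + 1).
Proof.
move=> /(_ ((theta + 1)%:C)); rewrite /halfplane/= => /(_ ltac:(lra)).
move=> /series_cvg_bounded[K K0 hK]; exists (2 * K) => n.
have : cabs (a n * dpow n.+1 (theta + 1)%:C) <= 2 * K.
  have := hK n.+1; rewrite seriesSr => h1; have h2 := hK n.
  set x : R[i] := series _ _ in h1 h2.
  have -> : a n * dpow n.+1 (theta + 1)%:C =
    (x + a n * dpow n.+1 (theta + 1)%:C) + - x by ring.
  by apply: le_trans (cabsD _ _) _; rewrite cabsN; lra.
by rewrite cabsM cabs_dpow/= powRN ler_pdivrMr ?powR_gt0.
Qed.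

(* If [m] is the first index with a nonzero coefficient, then, as s tends to
   +oo along the reals, the term of index [m] dominates the rest by the factor
   ((m + 2) / (m + 1))^s. *)
Lemma dirichlet_zero theta a : dirichlet_on theta a (fun=> 0) -> a = fun=> 0.
Proof.
move=> da; have [K hK] := dirichlet_coef_growth da.
have [Z Z0 hZ] := @zeta_bounded R 2 ltac:(lra).
have K0 : 0 <= K by have := hK 0%N; rewrite powR1 mulr1; apply: le_trans; exact: cabs_ge0.
apply/funext => m; elim/ltn_ind : m => m IH.
apply/eqP; rewrite -cabs_eq0; apply/negPn/negP => am.
have {}am : 0 < cabs (a m) by rewrite lt0r am cabs_ge0.
pose rho : R := m.+2%:R / m.+1%:R.
have rho1 : 1 < rho by rewrite /rho ltr_pdivlMr// mul1r ltr_nat.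
pose Q := K * Z * m.+1%:R `^ (theta + 3) / cabs (a m).
have Q0 : 0 <= Q by rewrite /Q !mulr_ge0 ?powR_ge0// invr_ge0 cabs_ge0.
have bound (x : nat) : rho ^+ x <= Q + 1.
  (* At [sg] the growth bound (i+1)^{theta+1} leaves (i+1)^{-2} (i+1)^{-x}: a summable factor, and
     one that is at most (m+2)^{-x} for i > m. *)
  pose sg : R := theta + 3 + x%:R.
  have sgth : halfplane theta (sg%:C : C) by have := ler0n R x; rewrite /halfplane/= /sg; lra.
  (* The tolerance is the leading term times rho^{-x}; it accounts for the 1 in [Q + 1], and the
     remaining terms for [Q]. *)
  have := da _ sgth; move=> /ccvgP /(_ (cabs (a m) * m.+1%:R `^ (- sg) * rho ^- x)).
  case.
    rewrite !mulr_gt0 ?powR_gt0// invr_gt0 exprn_gt0//; lra.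
  move=> N hN; have := hN (maxn N m.+1) (leq_maxl _ _).
  set X := maxn N m.+1; rewrite subr0 /series/=.
  have mX : (m < X)%N by rewrite leq_max leqnn orbT.
  rewrite big_mkord (bigD1 (Ordinal mX))//=.
  set S := \sum_(_ < _ | _) _ => le1.
  have : cabs S <= K * (m.+2%:R `^ (- x%:R) * Z).
    apply: le_trans (cabs_sum _ _ _) _.
    apply: le_trans (_ : _ <= \sum_(i < X) K * (m.+2%:R `^ (- x%:R) * i.+1%:R `^ (- 2))) _.
      rewrite big_mkcond; apply: ler_sum => i _; case: ifPn => im; last first.
        by rewrite !mulr_ge0 ?powR_ge0.
      have [im'|mi] := ltnP i m.
        by rewrite IH// mul0r cabs0 !mulr_ge0 ?powR_ge0.
      have {}mi : (m < i)%N by rewrite ltn_neqAle mi andbT eq_sym.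
      rewrite cabsM cabs_dpow/=.
      apply: le_trans (ler_wpM2r (powR_ge0 _ _) (hK i)) _.
      rewrite -mulrA ler_wpM2l//.
      rewrite -powRD; last by rewrite pnatr_eq0 implybT.
      have -> : theta + 1 + - sg = - x%:R + - 2 by rewrite /sg; ring.
      rewrite powRD; last by rewrite pnatr_eq0 implybT.
      by rewrite ler_wpM2r ?powR_ge0// powR_anti// ler_nat.
    by rewrite -!mulr_sumr ler_wpM2l// ler_wpM2l ?powR_ge0.
  move=> le2.
  have : cabs (a m) * m.+1%:R `^ (- sg) <=
      cabs (a m) * m.+1%:R `^ (- sg) * rho ^- x + K * (m.+2%:R `^ (- x%:R) * Z).
    have -> : cabs (a m) * m.+1%:R `^ (- sg) = cabs (a m * dpow m.+1 (sg%:C)).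
      by rewrite cabsM cabs_dpow.
    apply: le_trans (_ : _ <= cabs (a m * dpow m.+1 sg%:C + S) + cabs S) _.
      by rewrite -(cabsN S); apply: le_trans (cabsD _ _); rewrite addrK.
    by apply: lerD => //; rewrite cabsM cabs_dpow in le1 *.
  have -> : m.+1%:R `^ (- sg) = m.+1%:R `^ (- (theta + 3)) * m.+1%:R ^- x :> R.
    rewrite /sg opprD powRD; last by rewrite pnatr_eq0 implybT.
    by rewrite powR_invn.
  rewrite powR_invn// /Q /rho => h.
  have y0 : (0 : R) < m.+1%:R ^+ x by rewrite exprn_gt0.
  have z0 : (0 : R) < m.+2%:R ^+ x by rewrite exprn_gt0.
  have t0 : (0 : R) < m.+1%:R `^ (theta + 3) by rewrite powR_gt0.
  move: h; rewrite powRN !expr_div_n.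
  move: (m.+1%:R ^+ x : R) y0 (m.+2%:R ^+ x : R) z0 (m.+1%:R `^ (theta + 3) : R) t0
    => y y0 z z0 t t0 h.
  have : cabs (a m) / t / y * (z * t / cabs (a m)) <=
    (cabs (a m) / t / y * (z / y)^-1 + K * (z^-1 * Z)) * (z * t / cabs (a m)).
    apply: ler_wpM2r; first by rewrite divr_ge0 ?mulr_ge0 ?cabs_ge0// ltW.
    by move: h; rewrite !mulrA.
  rewrite (_ : cabs (a m) / t / y * _ = z / y); last first.
    by field; rewrite !gt_eqF.
  move=> /le_trans; apply; rewrite le_eqVlt; apply/orP; left; apply/eqP.
  by field; rewrite !gt_eqF.
(* Bernoulli's inequality, which contradicts [bound] for large [x]. *)
have lin (x : nat) : 1 + x%:R * (rho - 1) <= rho ^+ x.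
  elim: x => [|x IHx]; first by rewrite mul0r addr0 expr0.
  have rho0 : 0 <= rho by apply: ltW; apply: lt_trans rho1.
  rewrite exprS; have := ler_wpM2l rho0 IHx.
  move=> H; apply: le_trans H; rewrite -natr1.
  by have := mulr_ge0 (ler0n R x) (sqr_ge0 (rho - 1)); nra.
pose x := (Num.truncn (Q / (rho - 1))).+1.
have : Q / (rho - 1) < x%:R by exact: truncnS_gt.
rewrite ltr_pdivrMr; last by lra.
by move=> h; have := le_trans (lin x) (bound x); rewrite addrC lerD2r leNgt h.
Qed.

Lemma dirichlet_unique theta a b f :
  dirichlet_on theta a f -> dirichlet_on theta b f -> a = b.
Proof.
move=> da db; have : dirichlet_on theta (fun n => a n - b n) (fun=> 0).
  move=> s hs; rewrite -(subrr (f s)).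
  rewrite (_ : series _ = fun n => series (fun n => a n * dpow n.+1 s : C) n -
    series (fun n => b n * dpow n.+1 s : C) n).
    exact: cvgB (da s hs) (db s hs).
  apply/funext => n; rewrite /series/= -sumrB; apply: eq_bigr => i _.
  by rewrite mulrBl.
move=> /dirichlet_zero /funeqP h; apply/funext => n; apply/eqP.
by rewrite -subr_eq0 h.
Qed.

Lemma dirichlet_coefE theta a f : dirichlet_on theta a f -> dirichlet_coef theta f = a.
Proof.
move=> da; rewrite /dirichlet_coef; case: xgetP => [b _ db|/(_ a)//].
exact: dirichlet_unique db da.
Qed.

End DirichletTheory.

(** * Analyticity *)

Section ExpBounds.
Context {R : realType}.
Implicit Types x y : R.

(** The inequality 1 + y <= exp y at y = x and y = -x gives x <= exp x - 1 <= x exp x. *)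
Lemma expRB1_le x : `|expR x - 1| <= `|x| * expR `|x|.
Proof.
have h1 := expR_ge1Dx x; have h2 := expR_ge1Dx (- x).
have e0 := expR_gt0 x; have e1 : expR (- x) * expR x = 1 by rewrite -expRD addNr expR0.
have h3 : expR x - 1 <= x * expR x by nra.
have hx : expR x <= expR `|x| by rewrite ler_expR ler_norm.
have h0 : 1 <= expR `|x| by rewrite -expR0 ler_expR.
have [x0|x0] := leP 0 x.
  by move: hx h0; rewrite (ger0_norm x0) ger0_norm; nra.
have xe : expR x <= 1 by rewrite -expR0 ler_expR ltW.
by move: hx h0; rewrite (ltr0_norm x0) ler0_norm; nra.
Qed.

Lemma expRB1B_le x : `|expR x - 1 - x| <= x ^+ 2 * expR `|x|.
Proof.
have h1 := expR_ge1Dx x; have h2 := expR_ge1Dx (- x).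
have e0 := expR_gt0 x; have e1 : expR (- x) * expR x = 1 by rewrite -expRD addNr expR0.
have h3 : expR x - 1 <= x * expR x by nra.
rewrite ger0_norm; last by lra.
apply: (@le_trans _ _ (x * (expR x - 1))); first by nra.
apply: le_trans (ler_norm _) _; rewrite normrM.
by rewrite -(real_normK (num_real x)) expr2 -mulrA ler_wpM2l// expRB1_le.
Qed.

Lemma normr_sin_le y : `|sin y| <= `|y|.
Proof.
wlog y0 : y / 0 < y => [H|].
  have [|y0|<-] := ltgtP 0 y; [exact: H| |by rewrite sin0 normr0].
  by rewrite -normrN -sinN -(normrN y); apply: H; lra.
have [x _] := @MVT R (@sin R) (@cos R) 0 y y0
  (fun x _ => is_derive_sin x) (continuous_subspaceT (@continuous_sin R)).
rewrite sin0 !subr0 => ->; rewrite normrM ler_piMl//.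
by rewrite ler_norml cos_geN1 cos_le1.
Qed.

Lemma normr_cosB1_le y : `|cos y - 1| <= y ^+ 2.
Proof.
wlog y0 : y / 0 < y => [H|].
  have [|y0|<-] := ltgtP 0 y; [exact: H| |by rewrite cos0 subrr normr0 expr0n].
  by rewrite -cosN -sqrrN; apply: H; lra.
have [x xy] := @MVT R (@cos R) (fun t => - sin t) 0 y y0
  (fun x _ => is_derive_cos x) (continuous_subspaceT (@continuous_cos R)).
rewrite cos0 subr0 => ->; rewrite normrM normrN expr2 (gtr0_norm y0) ler_wpM2r ?(ltW y0)//.
apply: le_trans (normr_sin_le _) _; move: xy; rewrite in_itv/= => /andP[x0 xy].
by rewrite gtr0_norm// ltW.
Qed.

Lemma normr_cosB1_le_norm y : `|cos y - 1| <= `|y|.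
Proof.
wlog y0 : y / 0 < y => [H|].
  have [|y0|<-] := ltgtP 0 y; [exact: H| |by rewrite cos0 subrr normr0].
  by rewrite -cosN -(normrN y); apply: H; lra.
have [x _] := @MVT R (@cos R) (fun t => - sin t) 0 y y0
  (fun x _ => is_derive_cos x) (continuous_subspaceT (@continuous_cos R)).
rewrite cos0 subr0 => ->; rewrite normrM normrN ler_piMl//.
by rewrite ler_norml sin_geN1 sin_le1.
Qed.

Lemma normr_sinB_le y : `|sin y - y| <= y ^+ 2.
Proof.
wlog y0 : y / 0 < y => [H|].
  have [|y0|<-] := ltgtP 0 y; [exact: H| |by rewrite sin0 subrr normr0 expr0n].
  by have := H (- y) ltac:(lra); rewrite sinN opprK sqrrN addrC -normrN opprD opprK addrC.
have dB x : x \in `]0, y[%R -> is_derive x 1 (fun t : R => sin t - t) (cos x - 1).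
  by move=> _; apply: is_deriveB; exact: is_derive_sin.
have cB : continuous (fun t : R => sin t - t).
  by move=> x; apply: cvgB; [exact: continuous_sin|exact: cvg_id].
have [x xy] := MVT y0 dB (continuous_subspaceT cB).
rewrite sin0 !subr0 => ->; rewrite normrM expr2 (gtr0_norm y0) ler_wpM2r ?(ltW y0)//.
apply: le_trans (normr_cosB1_le_norm _) _; move: xy; rewrite in_itv/= => /andP[x0 xy].
by rewrite gtr0_norm// ltW.
Qed.

(** The second-order remainder needed to differentiate n^{-s}. Its real and imaginary parts split
    into two terms each, and each of the four is at most |z|^2 exp |z|. *)
Lemma cabs_cexpB1B_le (z : R[i]) :
  cabs (cexp z - 1 - z) <= 4 * cabs z ^+ 2 * expR (cabs z).
Proof.
have := normr_Re_le_cabs z; have := normr_Im_le_cabs z.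
case: z => x y /=; set m := cabs _ => ym xm.
apply: le_trans (cabs_le_ReIm _) _; rewrite /cexp /=.
set E := expR m; set e := expR x.
have m0 : 0 <= m by exact: cabs_ge0.
have e0 : 0 < e by exact: expR_gt0.
have xE : expR `|x| <= E by rewrite ler_expR.
have eE : e <= E by rewrite ler_expR (le_trans (ler_norm x)).
have x2 : x ^+ 2 <= m ^+ 2 by rewrite -(real_normK (num_real x)) lerXn2r ?nnegrE.
have y2 : y ^+ 2 <= m ^+ 2 by rewrite -(real_normK (num_real y)) lerXn2r ?nnegrE.
have E0 : 0 < E by exact: expR_gt0.
have bnd (u v : R) : 0 <= u -> u <= m ^+ 2 -> 0 <= v -> v <= E -> u * v <= m ^+ 2 * E.
  by move=> *; exact: ler_pM.
have -> : e * cos y - 0 * sin y - 1 - x = e * (cos y - 1) + (e - 1 - x) by ring.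
have -> : e * sin y + 0 * cos y - 0 - y = e * (sin y - y) + y * (e - 1) by ring.
have t1 : `|e * (cos y - 1)| <= m ^+ 2 * E.
  rewrite normrM mulrC (gtr0_norm e0) bnd// ?(ltW e0)//.
  exact: le_trans (normr_cosB1_le y) y2.
have t2 : `|e - 1 - x| <= m ^+ 2 * E.
  by apply: le_trans (expRB1B_le x) _; rewrite bnd// ?sqr_ge0// expR_ge0.
have t3 : `|e * (sin y - y)| <= m ^+ 2 * E.
  rewrite normrM mulrC (gtr0_norm e0) bnd// ?(ltW e0)//.
  exact: le_trans (normr_sinB_le y) y2.
have t4 : `|y * (e - 1)| <= m ^+ 2 * E.
  rewrite normrM; apply: le_trans (ler_wpM2l (normr_ge0 y) (expRB1_le x)) _.
  by rewrite mulrA bnd ?mulr_ge0 ?expR_ge0// expr2 ler_pM.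
have := ler_normD (e * (cos y - 1)) (e - 1 - x).
have := ler_normD (e * (sin y - y)) (y * (e - 1)).
by rewrite -mulrA; lra.
Qed.

End ExpBounds.

(** * Products and the theorem *)

Section Product.
Context {R : realType}.
Local Notation C := (R[i]^o).
Implicit Types (a b c : nat -> C) (f g : C -> C) (theta : R).

Lemma ccvg_scale (u : nat -> C) (l : C) (K : R) : 0 <= K ->
  (forall e : R, 0 < e -> exists N, forall n, (N <= n)%N -> cabs (u n - l) <= K * e) ->
  u @ \oo --> l.
Proof.
move=> K0 h; apply/ccvgP => e e0.
have [|N hN] := h (e / (K + 1)); first by rewrite divr_gt0//; lra.
exists N => n /hN /le_trans; apply; rewrite mulrCA ler_piMr ?(ltW e0)//.
by rewrite ler_pdivrMr; lra.
Qed.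

Lemma bounded_tail (x : nat -> R) (K e : R) : (forall n, 0 <= x n) ->
  (forall X, \sum_(n < X) x n <= K) -> 0 < e ->
  exists N, forall X, (N <= X)%N -> \sum_(n < X) x n - \sum_(n < N) x n <= e.
Proof.
move=> x0 xK e0.
have nd : nondecreasing_seq (fun X => \sum_(n < X) x n).
  by move=> m n mn; exact: ler_sum_widen.
have ub : has_ubound (range (fun X => \sum_(n < X) x n)).
  by exists K => _ [X _ <-].
have /cvg_ex[l hl] := nondecreasing_is_cvgn nd ub.
have lE := cvg_lim (@Rhausdorff R) hl.
have le_l X : \sum_(n < X) x n <= l.
  by rewrite -lE; apply: (nondecreasing_cvgn_le nd); apply/cvg_ex; exists l.
move/cvgrPdist_le : hl => /(_ _ e0)[N _ hN]; exists N => X NX.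
have := hN N (leqnn N); rewrite /= ger0_norm; last by rewrite subr_ge0 le_l.
by have := le_l X; lra.
Qed.

(** Mertens' argument: one series converges absolutely, the other merely converges. *)
Lemma dirichlet_mul theta a b f g :
  (forall s : C, halfplane theta s -> exists K, forall X,
     \sum_(n < X) cabs (a n) * n.+1%:R `^ (- complex.Re s) <= K) ->
  dirichlet_on theta a f -> dirichlet_on theta b g ->
  dirichlet_on theta (dconv a b) (f \* g).
Proof.
move=> absa da db s hs; have [K hK] := absa s hs.
pose al k : C := a k * dpow k.+1 s; pose be k : C := b k * dpow k.+1 s.
have {}hK X : \sum_(n < X) cabs (al n) <= K.
  by apply: le_trans (hK X); apply: ler_sum => n _; rewrite cabsM cabs_dpow.
have K0 : 0 <= K by have := hK 0%N; rewrite big_ord0.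
have ha : series al @ \oo --> f s := da s hs.
have hb : series be @ \oo --> g s := db s hs.
(* The hyperbola identity, by multiplicativity of n^{-s}. *)
have partial X : series (fun n => dconv a b n * dpow n.+1 s : C) X =
    \sum_(k < X) al k * series be (X %/ k.+1)%N.
  rewrite /series/= big_mkord.
  under [RHS]eq_bigr => k _ do rewrite big_mkord mulr_sumr.
  rewrite -(hyperbola (fun k j => al k * be j)); apply: eq_bigr => n _.
  rewrite /dconv mulr_suml; apply: eq_bigr => k _.
  rewrite mulr_suml; apply: eq_bigr => j /eqP E.
  have -> : dpow n.+1 s = dpow (k.+1 * j.+1) s by rewrite E.
  by rewrite dpowM /al /be; ring.
have [M M0 hM] := series_cvg_bounded hb.
pose M' := M + cabs (g s).
have M'0 : 0 <= M' by rewrite addr_ge0 ?cabs_ge0.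
apply: (@ccvg_scale _ _ (K + M' + cabs (g s))).
  by rewrite !addr_ge0 ?cabs_ge0.
move=> e e0.
move/ccvgP : ha => /(_ e e0)[N1 h1]; move/ccvgP : hb => /(_ e e0)[J hJ].
have [K1 hK1] := @bounded_tail (fun n => cabs (al n)) K e (fun n => cabs_ge0 _) hK e0.
(* For [k < K1], [J * K1 <= X] makes [X %/ k.+1] at least [J], so the inner partial sum is near its
   limit. For larger [k] that difference is only bounded by [M'], but the sum of the [al k] is
   small. *)
exists (maxn N1 (maxn K1 (J * K1))) => X.
rewrite !geq_max => /and3P[N1X K1X JX]; rewrite partial.
have -> : \sum_(k < X) al k * series be (X %/ k.+1)%N - (f \* g) s =
    \sum_(k < X) al k * (series be (X %/ k.+1)%N - g s) + (series al X - f s) * g s.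
  under [in RHS]eq_bigr => k _ do rewrite mulrBr.
  by rewrite sumrB -mulr_suml /series/= (big_mkord _ al); ring.
apply: le_trans (cabsD _ _) _; rewrite [leRHS]mulrDl; apply: lerD; last first.
  by rewrite cabsM mulrC ler_wpM2l ?cabs_ge0// h1.
apply: le_trans (cabs_sum _ _ _) _.
have bnd m : cabs (series be m - g s) <= M'.
  by apply: le_trans (cabsD _ _) _; rewrite cabsN lerD2r.
rewrite -(subnKC K1X) big_split_ord/= [leRHS]mulrDl; apply: lerD.
  apply: (@le_trans _ _ (\sum_(k < K1) cabs (al k) * e)); last first.
    by rewrite -mulr_suml ler_wpM2r// ltW.
  apply: ler_sum => k _; rewrite cabsM ler_wpM2l ?cabs_ge0// subnKC// hJ//.
  rewrite leq_divRL//; apply: leq_trans JX.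
  by rewrite leq_mul2l ltn_ord orbT.
apply: (@le_trans _ _ (M' * \sum_(k < X - K1) cabs (al (K1 + k)%N))).
  rewrite mulr_sumr; apply: ler_sum => k _.
  by rewrite cabsM mulrC ler_wpM2r ?cabs_ge0.
apply: ler_wpM2l => //; have := hK1 X K1X.
have -> : \sum_(n < X) cabs (al n) = \sum_(n < K1 + (X - K1)) cabs (al n).
  by rewrite subnKC.
by rewrite big_split_ord/= addrAC subrr add0r.
Qed.

End Product.

(** * Absolute convergence to the right of 1/q *)

Section CesaroAbs.
Context {R : realType}.
Implicit Types (A : nat -> R) (p sg M : R).

(* The dyadic block from 2^i to 2^{i+1} contributes at most a constant times
   2^{i (1/q - sg)}, by [ces_le_sum]. *)
Lemma ces_le_abs_cvg p A M sg : 1 < p -> 0 <= M -> (forall n, 0 <= A n) ->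
  ces_le p A M -> 1 - p^-1 < sg ->
  exists K, forall X, \sum_(n < X) A n * n.+1%:R `^ (- sg) <= K.
Proof.
move=> p1 M0 A0 lA; set r := 1 - p^-1 => rsg.
have r0 : 0 < r by rewrite subr_gt0 invf_lt1//; lra.
pose rho : R := 2 `^ (r - sg).
have rho0 : 0 < rho by rewrite powR_gt0.
have rho1 : rho < 1.
  rewrite /rho -opprB powRN invf_lt1 ?powR_gt0//.
  have := @gt0_ltr_powR R (sg - r) _ 1 2.
  by rewrite !nnegrE powR1; apply => //; lra.
pose D := 2 * M * 2 `^ r.
have D0 : 0 <= D by rewrite !mulr_ge0 ?powR_ge0.
pose V i := \sum_(n < 2 ^ i) A n * n.+1%:R `^ (- sg).
have step i : V i.+1 <= V i + D * rho ^+ i.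
  rewrite /V expnS mul2n -addnn big_split_ord/= lerD2l.
  apply: (@le_trans _ _ (\sum_(n < 2 ^ i) A (2 ^ i + n)%N * (2 ^ i)%:R `^ (- sg))).
    apply: ler_sum => n _; rewrite ler_wpM2l//; apply: powR_anti.
    - lra.
    - by rewrite ltr0n expn_gt0.
    - by rewrite ler_nat; lia.
  rewrite -mulr_suml.
  have : \sum_(n < 2 ^ i) A (2 ^ i + n)%N <= D * (2 ^ i)%:R `^ r.
    have := ces_le_sum p1 M0 A0 lA (2 ^ i + 2 ^ i); rewrite big_split_ord/=.
    rewrite (_ : (2 ^ i + 2 ^ i)%:R = 2 * (2 ^ i)%:R); last by rewrite addnn -mul2n natrM.
    rewrite powRM// -/r mulrA -/D; apply: le_trans.
    by rewrite lerDr; apply: sumr_ge0.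
  move=> /(ler_wpM2r (powR_ge0 (2 ^ i)%:R (- sg))) /le_trans; apply.
  rewrite -mulrA -powRD; last by rewrite pnatr_eq0 expn_eq0 implybT.
  by rewrite natrX -powR_mulrn// powRAC powR_mulrn ?powR_ge0.
have {}step i : V i <= V 0%N + D * ((1 - rho ^+ i) / (1 - rho)).
  elim: i => [|i IH]; first by rewrite expr0 subrr mul0r mulr0 addr0.
  apply: le_trans (step i) _; apply: le_trans (lerD IH (lexx _)) _.
  rewrite -addrA lerD2l -mulrDr ler_wpM2l// le_eqVlt; apply/orP; left; apply/eqP.
  by rewrite exprS; field; lra.
exists (V 0%N + D * (1 - rho)^-1) => X.
apply: (@le_trans _ _ (V X)).
  apply: (@ler_sum_widen _ (fun n => A n * n.+1%:R `^ (- sg))); last exact/ltnW/ltn_expl.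
  by move=> n; rewrite mulr_ge0 ?powR_ge0.
apply: le_trans (step X) _; rewrite lerD2l ler_wpM2l//.
by rewrite ler_piMl ?invr_ge0 ?gerBl ?exprn_ge0//; lra.
Qed.

End CesaroAbs.

(** * Complex differentiability of Dirichlet series *)

Section Analytic.
Context {R : realType}.
Local Notation C := (R[i]^o).
Implicit Types (a b c : nat -> C) (f g : C -> C) (theta : R).

Lemma cabs_lim_le (u : nat -> C) (l : C) (B : R) :
  u @ \oo --> l -> (forall n, cabs (u n) <= B) -> cabs l <= B.
Proof.
move=> /ccvgP ul uB; apply/ler_addgt0Pr => e e0; have [N hN] := ul e e0.
apply: le_trans (cabs_triangle_sub _ (u N)) _; apply: lerD => //.
by rewrite -cabsN opprB hN.
Qed.

Lemma derivable_of_quotient_bound f (s L : C) (delta K : R) : 0 < delta ->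
  (forall h : C, h != 0 -> cabs h <= delta ->
     cabs (h^-1 * (f (s + h) - f s) - L) <= K * cabs h) ->
  derivable f s 1.
Proof.
move=> d0 hK; apply/cvg_ex; exists L; apply/cvgrPdist_le => e e0.
have eE : e = (complex.Re e)%:C by rewrite RRe_real// ger0_real// ltW.
have e'0 : 0 < complex.Re e by rewrite -ltcR -eE.
pose d := Num.min delta (complex.Re e / (`|K| + 1)).
have K1 : 0 < `|K| + 1 by rewrite ltr_wpDl.
have dd : 0 < d by rewrite /d lt_min d0 divr_gt0.
apply/nbhs_ballP; exists d%:C; first by rewrite /= ltcR.
move=> h; rewrite /ball/= sub0r normrN normcE_cabs ltcR => hd h0.
rewrite distrC eE normcE_cabs lecR.
have -> : h *: (1 : C) = h by rewrite /GRing.scale/= mulr1.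
rewrite /GRing.scale/= addrC [h + s]addrC -[X in cabs X]addrC.
have hdel : cabs h <= delta by apply: (le_trans (ltW hd)); rewrite ge_min lexx.
apply: le_trans (hK h h0 hdel) _.
apply: le_trans (_ : _ <= `|K| * cabs h) _; first by rewrite ler_wpM2r ?cabs_ge0 ?ler_norm.
have : cabs h <= complex.Re e / (`|K| + 1).
  by apply: (le_trans (ltW hd)); rewrite ge_min lexx orbT.
rewrite ler_pdivlMr// => h1; have := cabs_ge0 h; have := normr_ge0 K; nra.
Qed.

(** From ln y <= y - 1 at y = x^d; it absorbs the logarithms produced by differentiation into a
    small power. *)
Lemma ln_le_powR (x d : R) : 0 < d -> 0 < x -> ln x <= x `^ d / d.
Proof.
move=> d0 x0; rewrite ler_pdivlMr// mulrC -ln_powR.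
have := @le_ln1Dx R (x `^ d - 1); rewrite addrCA subrr addr0.
by have := powR_gt0 d x0; move=> h0 h; have := h ltac:(lra); lra.
Qed.

(** The difference quotient minus the termwise derivative is bounded by a multiple of |h|, first for
    partial sums, uniformly in their length, and then in the limit. *)
Lemma abs_dirichlet_analytic theta a f (K : R) :
  (forall X, \sum_(n < X) cabs (a n) * n.+1%:R `^ (- theta) <= K) ->
  dirichlet_on theta a f -> analytic_on (halfplane theta) f.
Proof.
move=> aK da s hs; rewrite /halfplane/= in hs.
have K0 : 0 <= K by have := aK 0%N; rewrite big_ord0.
(* A third of the distance to the boundary: the remainder contains two factors ln(n+1) and one
   exp(|h| ln(n+1)) with |h| <= d, each costing a power (n+1)^d. *)
pose d : R := (complex.Re s - theta) / 3.
have d0 : 0 < d by rewrite /d; lra.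
pose lam n : R := ln n.+1%:R.
have lam0 n : 0 <= lam n by rewrite ln_ge0// ler1n.
have lamd n : lam n <= n.+1%:R `^ d / d by apply: ln_le_powR.
have p1 n : (1 : R) <= n.+1%:R by rewrite ler1n.
pose v n : C := a n * dpow n.+1 s * (- (lam n)%:C).
have wgt n (m : R) : 0 <= m -> m <= n.+1%:R `^ (3 * d) ->
    cabs (a n) * n.+1%:R `^ (- complex.Re s) * m <= cabs (a n) * n.+1%:R `^ (- theta).
  move=> m0 mn; rewrite -mulrA ler_wpM2l ?cabs_ge0//.
  have -> : - theta = - complex.Re s + 3 * d by rewrite /d; field.
  by rewrite powRD ?pnatr_eq0 ?implybT// ler_wpM2l ?powR_ge0.
have [L hL] : exists L : C, series v @ \oo --> L.
  apply: (@abs_series_cvg _ _ (d^-1 * K)) => X.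
  apply: le_trans (ler_wpM2l _ (aK X)); last by rewrite invr_ge0 ltW.
  rewrite mulr_sumr; apply: ler_sum => n _.
  rewrite /v 2!cabsM cabsN cabs_real cabs_dpow ger0_norm//.
  apply: le_trans (ler_wpM2l _ (lamd n)) _; first by rewrite mulr_ge0 ?cabs_ge0 ?powR_ge0.
  rewrite mulrA mulrC ler_wpM2l ?invr_ge0 ?(ltW d0)// wgt ?powR_ge0//.
  by apply: ler_powR => //; lra.
apply: (@derivable_of_quotient_bound f s L d (4 * (d ^- 2 * K))) => // h h0 hd.
have hsh : halfplane theta (s + h : C).
  rewrite /halfplane/=; have := normr_Re_le_cabs h; rewrite ler_norml => /andP[h1 _].
  have -> : complex.Re (s + h) = complex.Re s + complex.Re h.
    by case: (s) (h) => [? ?] [? ?].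
  have dE : 3 * d = complex.Re s - theta by rewrite /d; field.
  by lra.
pose w n : C := a n * dpow n.+1 (s + h).
pose w0 n : C := a n * dpow n.+1 s.
have lim : (fun X => h^-1 * (series w X - series w0 X) - series v X) @ \oo
    --> (h^-1 * (f (s + h) - f s) - L : C).
  have /ccvgP lw : series w @ \oo --> f (s + h) := da _ hsh.
  have /ccvgP lw0 : series w0 @ \oo --> f s := da _ hs.
  move/ccvgP : hL => lv; have h1 : 0 <= (cabs h)^-1 by rewrite invr_ge0 cabs_ge0.
  apply: (@ccvg_scale _ _ _ ((cabs h)^-1 * 2 + 1)); first by lra.
  move=> e e0; have [N1 h2] := lw e e0; have [N2 h3] := lw0 e e0.
  have [N3 h4] := lv e e0; exists (maxn N1 (maxn N2 N3)) => X.
  rewrite !geq_max => /and3P[/h2 {}h2 /h3 {}h3 /h4 {}h4].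
  set S := series w X in h2 *; set S0 := series w0 X in h3 *; set V := series v X in h4 *.
  have -> : h^-1 * (S - S0) - V - (h^-1 * (f (s + h) - f s) - L) =
      h^-1 * ((S - f (s + h)) + - (S0 - f s)) + - (V - L) by ring.
  apply: le_trans (cabsD _ _) _; rewrite cabsM cabsN cabsV.
  have := ler_wpM2l h1 (cabsD (S - f (s + h)) (- (S0 - f s))); rewrite cabsN.
  have := ler_wpM2l h1 (lerD h2 h3); lra.
apply: (cabs_lim_le lim) => X.
have termE n : h^-1 * (w n - w0 n) - v n =
    w0 n * h^-1 * (cexp (- h * (lam n)%:C) - 1 - (- h * (lam n)%:C)).
  rewrite /w /w0 /v dpowD -/(lam n).
  by field.
have -> : h^-1 * (series w X - series w0 X) - series v X =
    \sum_(n < X) (w0 n * h^-1 * (cexp (- h * (lam n)%:C) - 1 - (- h * (lam n)%:C))).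
  rewrite /series/= !big_mkord -sumrB mulr_sumr -sumrB.
  by apply: eq_bigr => n _; rewrite -termE.
apply: le_trans (cabs_sum _ _ _) _.
apply: (@le_trans _ _ (\sum_(n < X) 4 * (d ^- 2 * (cabs (a n) * n.+1%:R `^ (- theta))) * cabs h)).
  apply: ler_sum => n _; rewrite 2!cabsM cabsV /w0 (cabsM (a n)) cabs_dpow.
  have ch : 0 < cabs h by rewrite lt0r cabs_eq0 h0 cabs_ge0.
  apply: le_trans (ler_wpM2l _ (cabs_cexpB1B_le _)) _.
    by rewrite !mulr_ge0 ?cabs_ge0 ?powR_ge0// invr_ge0 cabs_ge0.
  rewrite cabsM cabsN cabs_real ger0_norm//.
  set E := expR _.
  have EE : E <= n.+1%:R `^ d.
    rewrite /E /powR pnatr_eq0/= ler_expR -/(lam n).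
    by rewrite ler_wpM2r.
  have : cabs (a n) * n.+1%:R `^ (- complex.Re s) * ((lam n * d) ^+ 2 * E) <=
         cabs (a n) * n.+1%:R `^ (- theta).
    apply: wgt; first by rewrite mulr_ge0 ?sqr_ge0 ?expR_ge0.
    have -> : 3 * d = d + d + d by ring.
    rewrite !powRD ?pnatr_eq0 ?implybT//; apply: ler_pM => //.
    - by rewrite sqr_ge0.
    - exact: expR_ge0.
    have ld : lam n * d <= n.+1%:R `^ d by rewrite -ler_pdivlMr.
    by rewrite expr2 ler_pM// mulr_ge0// ltW.
  set A := cabs (a n); set N := _ `^ (- complex.Re s); set T := A * _ `^ (- theta).
  move=> le.
  have -> : A * N * (cabs h)^-1 * (4 * (cabs h * lam n) ^+ 2 * E) =
      4 * (d ^- 2 * (A * N * ((lam n * d) ^+ 2 * E))) * cabs h.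
    by field; rewrite !gt_eqF.
  rewrite ler_pM2r// ler_pM2l//; apply: ler_wpM2l => //.
  by rewrite invr_ge0 exprn_ge0// ltW.
rewrite -mulr_suml ler_wpM2r ?cabs_ge0// -mulr_sumr ler_wpM2l// -mulr_sumr ler_wpM2l//.
by rewrite invr_ge0 exprn_ge0// ltW.
Qed.

End Analytic.

(** * Multipliers and their norms *)

Section Multipliers.
Context {R : realType}.
Local Notation C := (R[i]^o).
Implicit Types (a b c : nat -> C) (f g : C -> C) (p r theta : R).

Lemma ces_abs_dirichlet p a : 1 < p -> ces p a ->
  forall s : C, halfplane (1 - p^-1) s -> exists K, forall X,
    \sum_(n < X) cabs (a n) * n.+1%:R `^ (- complex.Re s) <= K.
Proof.
move=> p1 /(cesP _ p1)[M M0 aM] s hs.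
by apply: (@ces_le_abs_cvg _ p (cabs \o a) M) => // n; exact: cabs_ge0.
Qed.

Lemma weighted_l1_abs_dirichlet r a (T : R) :
  (forall X, \sum_(n < X) cabs (a n) * n.+1%:R `^ (- r) <= T) ->
  forall s : C, halfplane r s -> exists K, forall X,
    \sum_(n < X) cabs (a n) * n.+1%:R `^ (- complex.Re s) <= K.
Proof.
move=> aT s; rewrite /halfplane/= => hs; exists T => X.
apply: le_trans (aT X); apply: ler_sum => n _; rewrite ler_wpM2l ?cabs_ge0//.
by apply: ler_powR; [rewrite ler1n|lra].
Qed.

Lemma abs_dirichlet_cvg theta a :
  (forall s : C, halfplane theta s -> exists K, forall X,
     \sum_(n < X) cabs (a n) * n.+1%:R `^ (- complex.Re s) <= K) ->
  exists f, dirichlet_on theta a f.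
Proof.
move=> absa.
suff [f hf] : {f : C -> C & forall s, halfplane theta s ->
    series (fun n => a n * dpow n.+1 s : C) @ \oo --> f s} by exists f.
apply: (@choice _ _ (fun s l => halfplane theta s ->
  series (fun n => a n * dpow n.+1 s : C) @ \oo --> (l : C))) => s.
have [hs|] := pselect (halfplane theta s); last by exists 0.
have [K hK] := absa s hs.
have [l hl] : exists l : C, series (fun n => a n * dpow n.+1 s : C) @ \oo --> l.
  apply: (@abs_series_cvg _ _ K) => X; apply: le_trans (hK X).
  by apply: ler_sum => n _; rewrite cabsM cabs_dpow.
by exists l.
Qed.

Lemma ces_dirichlet p a : 1 < p -> ces p a -> exists f, dirichlet_on (1 - p^-1) a f.
Proof. by move=> p1 /(ces_abs_dirichlet p1) /abs_dirichlet_cvg. Qed.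

Definition unit_coef (n : nat) : C := (n == 0)%:R.

Lemma ces_unit_coef p : 1 < p -> ces p unit_coef.
Proof.
move=> p1; apply/cesP => //; have [Z Z0 hZ] := @zeta_bounded R p p1.
exists (Z `^ p^-1); first exact: powR_ge0.
move=> X; rewrite -powRrM mulVf ?powRr1//; last by rewrite gt_eqF//; lra.
apply: le_trans (hZ X); rewrite le_eqVlt; apply/orP; left; apply/eqP.
apply: eq_bigr => n _; rewrite powR_mulN// big_ord_recl/= big1 ?addr0.
  by rewrite /unit_coef eqxx cabs1 mul1r.
by move=> k _; rewrite /unit_coef/= cabs0.
Qed.

Lemma dirichlet_on_unit_coef theta : dirichlet_on theta unit_coef (fun=> 1).
Proof.
move=> s _; apply/ccvgP => e e0; exists 1%N => -[//|n] _.
rewrite /series/= big_mkord big_ord_recl/= big1; last first.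
  by move=> k _; rewrite /unit_coef/= mul0r.
by rewrite /unit_coef eqxx dpow1 addr0 mul1r subrr cabs0 ltW.
Qed.

(** The constant function 1 has coefficients [unit_coef] in ces_p, and f = f * 1. *)
Lemma multiplier_coef p q f : 1 < p -> q^-1 = 1 - p^-1 -> Multipliers p q f ->
  exists2 a, ces p a & dirichlet_on q^-1 a f.
Proof.
move=> p1 qE [_ /(_ (fun=> 1))]; rewrite (_ : f \* _ = f); last first.
  by apply/funext => s /=; rewrite mulr1.
apply; exists unit_coef; first exact: ces_unit_coef.
exact: dirichlet_on_unit_coef.
Qed.

Lemma Hces_norm_mul p q a b f g : 1 < p -> q^-1 = 1 - p^-1 -> ces p a ->
  dirichlet_on q^-1 a f -> dirichlet_on q^-1 b g ->
  Hces_norm p q (f \* g) = ces_norm p (dconv a b).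
Proof.
move=> p1 qE ca da db; rewrite /Hces_norm; congr ces_norm; apply: dirichlet_coefE.
by apply: dirichlet_mul => //; rewrite qE; exact: ces_abs_dirichlet.
Qed.

Lemma Hces_of_ces_le p q c (B : R) : 1 < p -> q^-1 = 1 - p^-1 -> 0 <= B ->
  ces_le p (cabs \o c) B ->
  exists g, [/\ Hces p q g, dirichlet_on q^-1 c g & (Hces_norm p q g <= B%:E)%E].
Proof.
move=> p1 qE B0 cB; have cc : ces p c by apply/cesP => //; exists B.
have [g dg] := ces_dirichlet p1 cc; rewrite -qE in dg.
exists g; split => //; first by exists c.
by rewrite /Hces_norm (dirichlet_coefE dg); apply/ces_norm_leP.
Qed.

(** Otherwise [gliding_hump] yields g in H(ces_p) for which the coefficients of f g, identified with
    the convolution by uniqueness, are not in ces_p. *)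
Lemma Multipliers_sub p q f : 1 < p -> q^-1 = 1 - p^-1 ->
  Multipliers p q f -> Aspace q^-1 f.
Proof.
move=> p1 qE mf; have [a ca da] := multiplier_coef p1 qE mf.
exists a => //; apply/weighted_l1_fin; apply: contrapT => aT.
have [|c c1 hc] := @gliding_hump _ p a p1.
  by rewrite -opprB -qE.
have [g [hg dg _]] := Hces_of_ces_le p1 qE ler01 c1.
have [b /(cesP _ p1)[M M0 bM] db] := mf.2 g hg.
have E : b = dconv a c.
  apply: dirichlet_unique db _; apply: dirichlet_mul => //.
  by rewrite qE; exact: ces_abs_dirichlet.
by apply: (hc M M0); rewrite -E.
Qed.

Lemma Aspace_sub p q f : 1 < p -> q^-1 = 1 - p^-1 ->
  Aspace q^-1 f -> Multipliers p q f.
Proof.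
move=> p1 qE [a /weighted_l1_fin[T aT] da]; split.
  exact: abs_dirichlet_analytic aT da.
move=> g [b /(cesP _ p1)[M M0 bM] db]; exists (dconv a b).
  apply/cesP => //; exists (T * M).
    by rewrite mulr_ge0//; have := aT 0%N; rewrite big_ord0.
  by apply: ces_le_dconv => //; rewrite -opprB -qE.
by apply: dirichlet_mul => //; exact: weighted_l1_abs_dirichlet aT.
Qed.

(** One inequality is the convolution estimate [ces_le_dconv], the other [multiplier_bound_ge], for
    which the bound on the unit ball is extended by homogeneity. *)
Lemma Multipliers_normE p q f : 1 < p -> q^-1 = 1 - p^-1 -> Multipliers p q f ->
  Multipliers_norm p q f = Aspace_norm q^-1 f.
Proof.
move=> p1 qE mf; have qE' : p^-1 - 1 = - q^-1 by rewrite qE opprB.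
have [a fa da] := Multipliers_sub p1 qE mf.
have [a' ca' da'] := multiplier_coef p1 qE mf.
have {a' ca' da'} ca : ces p a by rewrite (dirichlet_unique da da').
rewrite /Aspace_norm (dirichlet_coefE da); apply/eqP; rewrite eq_le; apply/andP; split.
  apply: ge_ereal_sup => _ [g [[b cb db] g1] <-].
  rewrite (Hces_norm_mul p1 qE ca da db).
  rewrite /Hces_norm (dirichlet_coefE db) in g1.
  have : (0 <= weighted_l1_norm q^-1 a)%E.
    by apply: nneseries_ge0 => n _ _; rewrite lee_fin mulr_ge0 ?powR_ge0 ?cabs_ge0.
  move=> w0; have wE : (fine (weighted_l1_norm q^-1 a))%:E = weighted_l1_norm q^-1 a.
    by rewrite fineK// ge0_fin_numE.
  rewrite -wE; apply/ces_norm_leP => //; first exact: fine_ge0.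
  rewrite -[fine _]mulr1; apply: ces_le_dconv => //.
    by rewrite qE'; apply/weighted_l1_leP; rewrite wE.
  by apply/ces_norm_leP.
have upper c : ces_le p (cabs \o c) 1 ->
    (ces_norm p (dconv a c) <= Multipliers_norm p q f)%E.
  move=> c1; have [g [hg dg g1]] := Hces_of_ces_le p1 qE ler01 c1.
  rewrite -(Hces_norm_mul p1 qE ca da dg).
  by apply: ereal_sup_ubound; exists g.
have S0 : (0 <= Multipliers_norm p q f)%E.
  apply: le_trans (upper (fun=> 0) _); first exact: ces_norm_ge0.
  move=> X; rewrite powR1 /ces_sum big1// => n _.
  by rewrite big1 ?mul0r ?powR0// ?gt_eqF//; [lra|move=> k _; rewrite /= cabs0].
case: (Multipliers_norm p q f) upper S0 => [M| |]// upper M0; last by rewrite leey.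
rewrite lee_fin in M0; apply/weighted_l1_leP; rewrite -qE'.
apply: (@multiplier_bound_ge _ p a M 0) => // c B _ B0 cB.
have Bi0 : 0 <= B^-1 by rewrite invr_ge0 ltW.
have /upper : ces_le p (cabs \o (fun n => B^-1%:C * c n)) 1.
  by have := ces_le_cabsZ Bi0 (ltW B0) cB; rewrite mulVf// gt_eqF.
move=> /(ces_norm_leP _ p1 M0) /(ces_le_cabsZ (ltW B0) M0); rewrite mulrC.
rewrite (_ : (fun n => B%:C * _) = dconv a c)//; apply/funext => n.
by rewrite dconvZr mulrA -rmorphM mulfV ?mul1r// gt_eqF.
Qed.

End Multipliers.

Theorem theorem4p8 (R : realType) (p q : R) (hp : 1 < p)
    (hpq : p^-1 + q^-1 = 1) :
  Multipliers p q = Aspace q^-1 /\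
  forall f : R[i]^o -> R[i]^o, Multipliers p q f ->
    Multipliers_norm p q f = Aspace_norm q^-1 f.
Proof.
have qE : q^-1 = 1 - p^-1 by rewrite -hpq addrAC subrr add0r.
split; last by move=> f; exact: Multipliers_normE.
by apply/seteqP; split=> f; [exact: Multipliers_sub|exact: Aspace_sub].
Qed.
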